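(* Let $\psi=f+h$ with $f:\mathbb{R}^n\to\mathbb{R}$ convex and twice continuously differentiable, $h(x)=\gamma\|x\|_1$, $\gamma>0$. Suppose that the basic assumption holds: the sublevel sets of $\psi$ are bounded, in particular $\mathcal{L}_\psi(x_0)=\{x\mid\psi(x)\le\psi(x_0)\}$ is bounded, and $\nabla f$ is $L_g$-Lipschitz on a convex open set containing $\mathcal{L}_\psi(x_0)$ and the trial points of the Two-Metric Adaptive Projection algorithm (TMAP, see context). Let TMAP be run with $H_k=[\nabla^2 f(x_k)]_{I_k^-\times I_k^-}$, and assume that the generated sequence $\{x_k\}$ admits a limit point $x^*\in X^*$ at which the strict complementarity, error bound, and Lipschitz Hessian assumptions (SC), (EB), (LH) of the context all hold. Then there is $K$ such that $x_k\in\mathcal{M}_*$ for all $k\ge K$, and $x_k\to x^*$ superlinearly with parameter $1+\delta$, i.e. $x_k\to x^*$ and there is a constant $C$ such that $\|x_{k+1}-x^*\|\le C\|x_k-x^*\|^{1+\delta}$ for all sufficiently large $k$. Here $\delta\in(0,1)$ is the algorithm parameter.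
   Context: Notation: $\|\cdot\|$ is the Euclidean norm (operator norm for matrices); $x^i$ is the $i$th component of $x$; $[a]_I$, $[A]_{I\times I}$ denote subvectors and submatrices; $B(x,r)$ is the ball of radius $r$ about $x$; $\operatorname{dist}(x,S)=\inf_{y\in S}\|x-y\|$. $X^*$ is the set of global minimizers of $\psi$. For $\alpha>0$, $\operatorname{prox}_{\alpha h}(x)=\arg\min_u\{\alpha h(u)+\frac12\|u-x\|^2\}$, componentwise soft-thresholding at level $\alpha\gamma$. $\mathcal{A}(x)=\{i\mid x^i=0\}$ and $\mathcal{M}_*=\{x\in\mathbb{R}^n: x^i=0\ \forall i\in\mathcal{A}(x^* )\}$. Assumptions at $x^*$: (SC) $0\in\operatorname{relint}(\nabla f(x^* )+\partial h(x^* ))$. (EB) There are $b_1>0$, $c_1>0$ such that $c_1\|x-\operatorname{prox}_h(x-\nabla f(x))\|\ge\operatorname{dist}(x,X^* )$ for all $x\in B(x^*,b_1)$. (LH) There is $b_2>0$ such that $\operatorname{Hess}_{\mathcal{M}_*}f$ is Lipschitz continuous over $B(x^*,b_2)\cap\mathcal{M}_*$, where $\operatorname{Hess}_{\mathcal{M}_*}f(x)[\eta]$ is the orthogonal projection of $\nabla^2 f(x)\eta$ onto the subspace $\mathcal{M}_*$, for $\eta\in\mathcal{M}_*$. TMAP algorithm. Parameters: $\epsilon>0$, $\sigma,\beta,\tau,\delta\in(0,1)$, $c>0$, initial point $x_0$. At iteration $k$ let $g_k=\nabla f(x_k)$, $\pi_k=\|x_k-\operatorname{prox}_h(x_k-g_k)\|$,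 $\epsilon_k=\min\{\epsilon,\pi_k\}$. (Index sets) $I_k^{-+}=\{i: x_k^i>\epsilon_k\}\cup\{i:0\le x_k^i\le\epsilon_k,\ g_k^i\le-\gamma\}$; $I_k^{--}=\{i: x_k^i<-\epsilon_k\}\cup\{i:-\epsilon_k\le x_k^i\le 0,\ g_k^i\ge\gamma\}$; $I_k^-=I_k^{-+}\cup I_k^{--}$; $I_k^+=\{1,\dots,n\}\setminus I_k^-$. (Direction) $\omega_k\in\mathbb{R}^n$ has $\omega_k^i=\gamma$ for $i\in I_k^{-+}$, $-\gamma$ for $i\in I_k^{--}$, $0$ for $i\in I_k^+$. Let $\mu_k=c\,\big(\|[x_k-\operatorname{prox}_h(x_k-g_k)]_{I_k^+}\|^2+\|[g_k+\omega_k]_{I_k^-}\|^2\big)^{\delta/2}$; it is assumed throughout that $\mu_k>0$ for all $k$ (no iterate is stationary). $H_k=[\nabla^2 f(x_k)]_{I_k^-\times I_k^-}\succeq0$. Write $\bar g_k,\bar\omega_k,\bar p_k,\bar r_k$ for the subvectors indexed by $I_k^-$. The direction $p_k$ satisfies $p_k^i=g_k^i$ for $i\in I_k^+$ and $\bar p_k=(H_k+\mu_k I)^{-1}(\bar g_k+\bar\omega_k+\bar r_k)$ for some residual $\bar r_k$ with $\|\bar r_k\|\le\tau\min\{\mu_k\|\bar p_k\|,\|\bar g_k+\bar\omega_k\|\}$. (Trial points) For $t>0$: $x_k^i(t)=\max\{x_k^i-tp_k^i,0\}$ for $i\in I_k^{-+}$; $x_k^i(t)=\min\{x_k^i-tp_k^i,0\}$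 for $i\in I_k^{--}$; $x_k^i(t)=\operatorname{prox}_{t\gamma|\cdot|}(x_k^i-tp_k^i)$ for $i\in I_k^+$. With the superscript $+$ denoting subvectors indexed by $I_k^+$, let $G_t(x_k^+;g_k^+)=(x_k^+-x_k^+(t))/t$. (Linesearch) $t_k$ is the first element of $1,\beta,\beta^2,\dots$ with $\psi(x_k)-\psi(x_k(t_k))\ge\sigma t_k(1-\tau)\mu_k\|\bar p_k\|^2+\sigma t_k\|G_{t_k}(x_k^+;g_k^+)\|^2$; then $x_{k+1}=x_k(t_k)$. The linesearch trial points are the points $x_k(\beta^j)$, $k,j\ge 0$. *)

(* Defs.v *)
(* Over an arbitrary [R : realType]; R^n is the type ['rV[R]_n] of row vectors. *)
From HB Require Import structures.
From mathcomp Require Import all_boot all_order all_algebra.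
From mathcomp Require Import all_classical all_reals all_analysis.

Set Implicit Arguments.
Unset Strict Implicit.
Unset Printing Implicit Defensive.

Import Order.TTheory GRing.Theory Num.Theory.
Import numFieldNormedType.Exports.

Local Open Scope classical_set_scope.
Local Open Scope ring_scope.

Section Euclidean.
Context {R : realType} {n : nat}.
Implicit Types (u v x y : 'rV[R]_n) (S M : set 'rV[R]_n).

Definition dotp u v : R := \sum_i u 0 i * v 0 i.

(* The norm [`|_|] of the library on matrices is the sup norm; it induces the
   same topology and the same bounded sets as the Euclidean norm below. *)
Definition enorm v : R := Num.sqrt (dotp v v).

Definition eball x (r : R) : set 'rV[R]_n := [set y | enorm (y - x) < r].

Definition edist x S : R := inf [set enorm (x - y) | y in S].

Definition elipschitz_on (L : R) S (F : 'rV[R]_n -> 'rV[R]_n) : Prop :=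
  forall x y, S x -> S y -> enorm (F x - F y) <= L * enorm (x - y).

Definition affine_hull S : set 'rV[R]_n :=
  [set x | exists (m : nat) (a : 'I_m -> R) (q : 'I_m -> 'rV[R]_n),
     [/\ forall i, S (q i), \sum_i a i = 1 & x = \sum_i a i *: q i]].

Definition relint S : set 'rV[R]_n :=
  [set x | S x /\ exists2 r, 0 < r & eball x r `&` affine_hull S `<=` S].

Definition orthogonal_projection M v : 'rV[R]_n :=
  get [set w | M w /\ forall z, M z -> dotp (v - w) z = 0].

(* Operator norm of the restriction of the linear map [A] to the subspace
   [M]. *)
Definition opnorm_on M (A : 'rV[R]_n -> 'rV[R]_n) : R :=
  sup [set enorm (A v) | v in M `&` [set v | enorm v <= 1]].

(* ['D_v] is the derivative in the direction [v]. *)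
Definition grad (f : 'rV[R]_n -> R) x : 'rV[R]_n :=
  \row_i 'D_(delta_mx 0 i) f x.

(* Following the convention of ['J], the Hessian acts on row vectors from the
   right: the vector nabla^2 f(x) v is [v *m hess f x]. *)
Definition hess (f : 'rV[R]_n -> R) x : 'M[R]_n := 'J (grad f) x.

Definition twice_cont_diff (f : 'rV[R]_n -> R) : Prop :=
  [/\ forall x, differentiable f x,
      forall x, differentiable (grad f) x
    & continuous (hess f)].

Definition subdiff (h : 'rV[R]_n -> R) x : set 'rV[R]_n :=
  [set v | forall y, h x + dotp v (y - x) <= h y].

Definition minimizers (psi : 'rV[R]_n -> R) : set 'rV[R]_n :=
  [set x | forall y, psi x <= psi y].

Definition sublevel (psi : 'rV[R]_n -> R) (a : R) : set 'rV[R]_n :=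
  [set x | psi x <= a].

(* Subvector and principal submatrix, the indices in [I] being listed in
   increasing order. *)
Definition subvec (I : {set 'I_n}) v : 'rV[R]_#|I| :=
  colsub (fun j : 'I_#|I| => enum_val j) v.

Definition submat (I : {set 'I_n}) (A : 'M[R]_n) : 'M[R]_#|I| :=
  mxsub (fun j : 'I_#|I| => enum_val j) (fun j : 'I_#|I| => enum_val j) A.

End Euclidean.

(* An arbitrary minimizer, or an unspecified point when there is none. *)
Definition argmin {R : realType} {T : pointedType} (F : T -> R) : T :=
  get [set u | forall v, F u <= F v].

Definition prox {R : realType} {n : nat} (alpha : R) (h : 'rV[R]_n -> R)
    (x : 'rV[R]_n) : 'rV[R]_n :=
  argmin (fun u => alpha * h u + 2^-1 * enorm (u - x) ^+ 2).

Definition prox_abs {R : realType} (alpha : R) (x : R) : R :=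
  argmin (fun u : R => alpha * `|u| + 2^-1 * (u - x) ^+ 2).

Record tmap_params (R : realType) := TmapParams {
  tm_eps : R;
  tm_sigma : R;
  tm_beta : R;
  tm_tau : R;
  tm_delta : R;
  tm_c : R
}.

Definition valid_params {R : realType} (P : tmap_params R) : Prop :=
  [/\ 0 < tm_eps P, 0 < tm_sigma P < 1, 0 < tm_beta P < 1, 0 < tm_tau P < 1
    & 0 < tm_delta P < 1 /\ 0 < tm_c P].

Section TMAP.
Context {R : realType} {n : nat}.
Variables (f : 'rV[R]_n -> R) (gamma : R).
Implicit Types (x p : 'rV[R]_n) (t : R).

Definition l1reg x : R := gamma * \sum_i `|x 0 i|.

Definition psi x : R := f x + l1reg x.

Definition prox_residual x : 'rV[R]_n := x - prox 1 l1reg (x - grad f x).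

Variable P : tmap_params R.

Definition eps_at x : R := Num.min (tm_eps P) (enorm (prox_residual x)).

(* Suffixes: [I_mp] is I^{-+}, [I_mm] is I^{--}, [I_m] is I^-, [I_p] is I^+. *)
Definition I_mp x : {set 'I_n} :=
  [set i | (eps_at x < x 0 i) ||
           [&& 0 <= x 0 i, x 0 i <= eps_at x & grad f x 0 i <= - gamma]].

Definition I_mm x : {set 'I_n} :=
  [set i | (x 0 i < - eps_at x) ||
           [&& - eps_at x <= x 0 i, x 0 i <= 0 & gamma <= grad f x 0 i]].

Definition I_m x : {set 'I_n} := I_mp x :|: I_mm x.

Definition I_p x : {set 'I_n} := ~: I_m x.

Definition omega x : 'rV[R]_n :=
  \row_i (if i \in I_mp x then gamma else if i \in I_mm x then - gamma else 0).

Definition mu x : R :=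
  tm_c P * (enorm (subvec (I_p x) (prox_residual x)) ^+ 2 +
            enorm (subvec (I_m x) (grad f x + omega x)) ^+ 2)
           `^ (tm_delta P / 2).

Definition H_at x : 'M[R]_#|I_m x| := submat (I_m x) (hess f x).

(* The inverse multiplies row vectors on the right, as [hess] does. *)
Definition tmap_direction x p : Prop :=
  (forall i, i \in I_p x -> p 0 i = grad f x 0 i) /\
  exists r : 'rV[R]_#|I_m x|,
    let pbar := subvec (I_m x) p in
    let gbar := subvec (I_m x) (grad f x) in
    let obar := subvec (I_m x) (omega x) in
    pbar = (gbar + obar + r) *m invmx (H_at x + (mu x)%:M) /\
    enorm r <= tm_tau P * Num.min (mu x * enorm pbar) (enorm (gbar + obar)).

Definition trial x p t : 'rV[R]_n :=
  \row_i (if i \in I_mp x then Num.max (x 0 i - t * p 0 i) 0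
          else if i \in I_mm x then Num.min (x 0 i - t * p 0 i) 0
          else prox_abs (t * gamma) (x 0 i - t * p 0 i)).

Definition grad_map x p t : 'rV[R]_#|I_p x| :=
  t^-1 *: (subvec (I_p x) x - subvec (I_p x) (trial x p t)).

Definition suff_decrease x p t : Prop :=
  tm_sigma P * t * (1 - tm_tau P) * mu x * enorm (subvec (I_m x) p) ^+ 2 +
  tm_sigma P * t * enorm (grad_map x p t) ^+ 2
  <= psi x - psi (trial x p t).

Definition linesearch x p t : Prop :=
  exists j : nat,
    [/\ t = tm_beta P ^+ j,
        suff_decrease x p (tm_beta P ^+ j)
      & forall i : nat, (i < j)%N -> ~ suff_decrease x p (tm_beta P ^+ i)].

(* [x] is a sequence of iterates with directions [p] and step lengths [t]. *)
Definition tmap_run (x p : nat -> 'rV[R]_n) (t : nat -> R) : Prop :=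
  forall k : nat,
    [/\ tmap_direction (x k) (p k),
        linesearch (x k) (p k) (t k)
      & x k.+1 = trial (x k) (p k) (t k)].

Variable xs : 'rV[R]_n.

Definition active_manifold : set 'rV[R]_n :=
  [set x | forall i, xs 0 i = 0 -> x 0 i = 0].

Definition strict_complementarity : Prop :=
  relint [set grad f xs + v | v in subdiff l1reg xs] 0.

Definition error_bound : Prop :=
  exists b c : R, [/\ 0 < b, 0 < c &
    forall x, eball xs b x ->
      edist x (minimizers psi) <= c * enorm (prox_residual x)].

Definition hess_manifold x (eta : 'rV[R]_n) : 'rV[R]_n :=
  orthogonal_projection active_manifold (eta *m hess f x).

Definition lipschitz_hessian : Prop :=
  exists2 b, 0 < b & exists L : R,
    forall x y, (eball xs b `&` active_manifold) x ->
                (eball xs b `&` active_manifold) y ->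
      opnorm_on active_manifold
        (fun eta => hess_manifold x eta - hess_manifold y eta)
      <= L * enorm (x - y).

End TMAP.

(* Main.v *)
(* Let D be the set of indices i with xs_i <> 0, let M be [active_manifold xs],
   and let res(x) be the vector with entries x_i off D and
   (grad f x)_i + gamma sg(xs_i) on D. Strict complementarity gives
   |(grad f xs)_i| < gamma off D, so on a ball about xs the proximal residual is
   res(x), I^-(x) = D, and mu(x) = c |res(x)|^delta. There the argument runs in
   two stages.

   Identification: sufficient decrease holds for every t <= kappa mu(x), so the
   accepted step is at least of order |res(x)|^delta, while |x_i| <= |res(x)|
   off D. As delta < 1, soft thresholding at level t gamma sets all these
   coordinates to 0: one step from a point close to xs lands in M, still close
   to xs.

   Newton phase: on M write q for the D-part of the direction, H for the Hessian
   and u = x - z with z a minimizer such that |u| <= 2 c1 |res(x)| (error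
   bound). The Lipschitz Hessian gives res(x) = H u + O(|u|^2), and comparing the
   regularized system for q with this expansion gives |q| = O(|res(x)|), because
   |u|^2 is dominated by mu(x) |u|. Then t = 1 is accepted, again because
   |q| is dominated by mu(x), and
   |res(x - q)| <= (1 + tau) mu(x) |q| + O(|q|^2) = O(|res(x)|^(1 + delta)).

   Finally the residuals decrease geometrically, so the step lengths telescope to
   |x_l - x_k| <= 2 Cp |res(x_k)| for l >= k; as xs is a limit point this yields
   convergence and |x_k - xs| <= 2 Cp |res(x_k)|, whence the rate. *)
Require Import Defs.
From mathcomp Require Import all_boot all_order all_algebra.
From mathcomp Require Import all_classical all_reals all_analysis.
From mathcomp Require Import ring lra.

Set Implicit Arguments.
Unset Strict Implicit.
Unset Printing Implicit Defensive.

Import Order.TTheory GRing.Theory Num.Theory.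
Import numFieldNormedType.Exports.

Local Open Scope classical_set_scope.
Local Open Scope ring_scope.

(** * Euclidean norm, coordinate projections and the regularized system *)

Section EuclideanNorm.
Context {R : realType} {n : nat}.
Implicit Types (u v w x y : 'rV[R]_n) (a b : R) (I : {set 'I_n}).

Lemma dotpC u v : dotp u v = dotp v u.
Proof. by apply: eq_bigr => i _; rewrite mulrC. Qed.

Lemma dotpDr u v w : dotp u (v + w) = dotp u v + dotp u w.
Proof. by rewrite -big_split /=; apply: eq_bigr => i _; rewrite mxE mulrDr. Qed.

Lemma dotpNr u v : dotp u (- v) = - dotp u v.
Proof. by rewrite -sumrN; apply: eq_bigr => i _; rewrite mxE mulrN. Qed.

Lemma dotpBr u v w : dotp u (v - w) = dotp u v - dotp u w.
Proof. by rewrite dotpDr dotpNr. Qed.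

Lemma dotpZr a u v : dotp u (a *: v) = a * dotp u v.
Proof. by rewrite mulr_sumr; apply: eq_bigr => i _; rewrite mxE mulrCA. Qed.

Lemma dotpDl u v w : dotp (u + v) w = dotp u w + dotp v w.
Proof. by rewrite dotpC dotpDr !(dotpC w). Qed.

Lemma dotpNl u v : dotp (- u) v = - dotp u v.
Proof. by rewrite dotpC dotpNr dotpC. Qed.

Lemma dotpBl u v w : dotp (u - v) w = dotp u w - dotp v w.
Proof. by rewrite dotpDl dotpNl. Qed.

Lemma dotpZl a u v : dotp (a *: u) v = a * dotp u v.
Proof. by rewrite dotpC dotpZr dotpC. Qed.

Lemma dotp0r u : dotp u 0 = 0.
Proof. by rewrite /dotp big1// => i _; rewrite mxE mulr0. Qed.

Lemma dotp_ge0 u : 0 <= dotp u u.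
Proof. by apply: sumr_ge0 => i _; rewrite -expr2 sqr_ge0. Qed.

Lemma enorm_ge0 u : 0 <= enorm u.
Proof. exact: sqrtr_ge0. Qed.

Lemma sqr_enorm u : enorm u ^+ 2 = dotp u u.
Proof. by rewrite sqr_sqrtr ?dotp_ge0. Qed.

Lemma le_abs_enorm u i : `|u 0 i| <= enorm u.
Proof.
rewrite -[leLHS](@ger0_norm _ _)// -sqrtr_sqr ler_wsqrtr// real_normK ?num_real//.
rewrite /dotp (bigD1 i)//= -expr2 lerDl.
by apply: sumr_ge0 => j _; rewrite -expr2 sqr_ge0.
Qed.

Lemma enorm_eq0 u : enorm u = 0 -> u = 0.
Proof.
move=> u0; apply/rowP => i; rewrite mxE; apply/eqP.
by rewrite -normr_le0 -u0 le_abs_enorm.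
Qed.

Lemma enorm_gt0 u : u != 0 -> 0 < enorm u.
Proof.
move=> u0; rewrite lt_neqAle enorm_ge0 andbT eq_sym.
by apply: contra_neq u0 => /enorm_eq0.
Qed.

Lemma enorm0 : enorm (0 : 'rV[R]_n) = 0.
Proof. by rewrite /enorm dotp0r sqrtr0. Qed.

Lemma enormZ a u : enorm (a *: u) = `|a| * enorm u.
Proof.
by rewrite /enorm dotpZl dotpZr mulrA -expr2 sqrtrM ?sqr_ge0// sqrtr_sqr.
Qed.

Lemma enormN u : enorm (- u) = enorm u.
Proof. by rewrite -scaleN1r enormZ normrN1 mul1r. Qed.

Lemma enormBC u v : enorm (u - v) = enorm (v - u).
Proof. by rewrite -enormN opprB. Qed.

Lemma dotp_le_enorm u v : dotp u v <= enorm u * enorm v.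
Proof.
have [->|u0] := eqVneq u 0; first by rewrite dotpC dotp0r mulr_ge0 ?enorm_ge0.
have [->|v0] := eqVneq v 0; first by rewrite dotp0r mulr_ge0 ?enorm_ge0.
have := dotp_ge0 (enorm v *: u - enorm u *: v).
rewrite dotpBl !dotpBr !dotpZl !dotpZr (dotpC v u) -!sqr_enorm.
have := mulr_gt0 (enorm_gt0 u0) (enorm_gt0 v0).
set a := enorm u; set b := enorm v => ab.
set e := dotp u v => h.
have : 0 <= (2 * (a * b)) * (a * b - e).
  by apply: le_trans h _; rewrite le_eqVlt; apply/orP; left; apply/eqP; ring.
by rewrite pmulr_rge0 ?subr_ge0// mulr_gt0.
Qed.

Lemma enormD_le u v : enorm (u + v) <= enorm u + enorm v.
Proof.
rewrite -(@ler_pXn2r _ 2)// ?nnegrE ?addr_ge0 ?enorm_ge0// sqr_enorm.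
rewrite dotpDl !dotpDr (dotpC v u) -!sqr_enorm sqrrD.
have := dotp_le_enorm u v; lra.
Qed.

Lemma enormB_le u v : enorm (u - v) <= enorm u + enorm v.
Proof. by rewrite -(enormN v) enormD_le. Qed.

Lemma enorm_split z u v : enorm (u - v) <= enorm (u - z) + enorm (z - v).
Proof. by rewrite (_ : u - v = (u - z) + (z - v)) ?enormD_le// addrA subrK. Qed.

Lemma le_enorm_coord u v : (forall i, `|u 0 i| <= `|v 0 i|) -> enorm u <= enorm v.
Proof.
move=> uv; rewrite ler_wsqrtr//; apply: ler_sum => i _.
rewrite -!expr2 -(real_normK (num_real (u 0 i))) -(real_normK (num_real (v 0 i))).
by rewrite lerXn2r ?nnegrE.
Qed.

Lemma enorm_le_sum u : enorm u <= \sum_i `|u 0 i|.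
Proof.
have s0 : 0 <= \sum_i `|u 0 i| by apply: sumr_ge0.
rewrite -(@ler_pXn2r _ 2)// ?nnegrE ?enorm_ge0// sqr_enorm expr2 mulr_suml.
apply: ler_sum => i _; rewrite -expr2 -(real_normK (num_real _)) expr2.
by rewrite ler_wpM2l// (bigD1 i)//= lerDl sumr_ge0.
Qed.

Lemma enorm_le_mxnorm u : enorm u <= n%:R * `|u|.
Proof.
apply: le_trans (enorm_le_sum u) _.
have : \sum_i `|u 0 i| <= \sum_(i < n) `|u|.
  apply: ler_sum => i _; rewrite [leRHS]mx_normrE.
  exact: (le_bigmax _ (fun ij : 'I_1 * 'I_n => `|u ij.1 ij.2|) (0, i)).
by rewrite sumr_const card_ord mulr_natl.
Qed.

Lemma mxnorm_le_enorm u : `|u| <= enorm u.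
Proof.
rewrite /Num.norm/= mx_normrE; apply: bigmax_le; first exact: enorm_ge0.
by case=> i j _ /=; rewrite ord1 le_abs_enorm.
Qed.

Lemma nbhs_enormP x (A : set 'rV[R]_n) :
  nbhs x A <-> exists2 r, 0 < r & eball x r `<=` A.
Proof.
split.
  move=> /nbhs_ballP[r /= r0 rA].
  exists r => // y yr; apply: rA => /=.
  rewrite -ball_normE /ball_/= distrC.
  by apply: le_lt_trans yr; apply: mxnorm_le_enorm.
case=> r r0 rA; apply/nbhs_ballP.
(* [n.+1] instead of [n] keeps the divisor nonzero in dimension 0. *)
exists (r / n.+1%:R) => /=; first by rewrite divr_gt0.
move=> y; rewrite -ball_normE /ball_/= distrC => yx; apply: rA; rewrite /eball/=.
apply: le_lt_trans (enorm_le_mxnorm _) _.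
rewrite ltr_pdivlMr// mulrC in yx; apply: le_lt_trans yx.
by rewrite ler_wpM2r// ler_nat.
Qed.

Lemma near_eball x (A : 'rV[R]_n -> Prop) : (\forall y \near x, A y) ->
  exists2 r, 0 < r & forall y, enorm (y - x) < r -> A y.
Proof. by move=> /nbhs_enormP[r r0 rA]; exists r. Qed.

(** The length of [subvec I v] depends on [I], hence on the iterate. Zeroing the entries off [I]
    keeps all vectors in one space; [enorm_subvec] and [subvec_mulmx] translate between the two
    encodings. *)
Definition cproj I v : 'rV[R]_n := \row_i (if i \in I then v 0 i else 0).

Lemma cprojD I u v : cproj I (u + v) = cproj I u + cproj I v.
Proof. by apply/rowP => i; rewrite !mxE; case: ifP; rewrite ?addr0. Qed.

Lemma cprojN I u : cproj I (- u) = - cproj I u.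
Proof. by apply/rowP => i; rewrite !mxE; case: ifP; rewrite ?oppr0. Qed.

Lemma cprojB I u v : cproj I (u - v) = cproj I u - cproj I v.
Proof. by rewrite cprojD cprojN. Qed.

Lemma cprojZ I a u : cproj I (a *: u) = a *: cproj I u.
Proof. by apply/rowP => i; rewrite !mxE; case: ifP; rewrite ?mulr0. Qed.

Lemma cproj_id I u : cproj I (cproj I u) = cproj I u.
Proof. by apply/rowP => i; rewrite !mxE; case: ifP => // ->. Qed.

Lemma dotp_cprojl I u v : dotp (cproj I u) v = dotp u (cproj I v).
Proof.
by apply: eq_bigr => i _; rewrite !mxE; case: ifP; rewrite ?mulr0 ?mul0r.
Qed.

Lemma enorm_cproj I u : enorm (cproj I u) <= enorm u.
Proof. by apply: le_enorm_coord => i; rewrite mxE; case: ifP; rewrite ?normr0. Qed.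

Lemma sqr_enorm_cprojC I u :
  enorm u ^+ 2 = enorm (cproj I u) ^+ 2 + enorm (cproj (~: I) u) ^+ 2.
Proof.
rewrite !sqr_enorm -big_split; apply: eq_bigr => i _.
by rewrite !mxE finset.in_setC; case: (i \in I); rewrite /= ?mulr0 ?addr0 ?add0r.
Qed.

Lemma dotp_subvec I u v : dotp (subvec I u) (subvec I v) = dotp (cproj I u) (cproj I v).
Proof.
rewrite /dotp /subvec.
rewrite (eq_bigr (fun j : 'I_#|I| => u 0 (enum_val j) * v 0 (enum_val j))); last first.
  by move=> j _; rewrite !mxE.
rewrite -(big_enum_val (A := mem I) (fun i => u 0 i * v 0 i)) big_mkcond /=.
by apply: eq_bigr => i _; rewrite !mxE; case: ifP; rewrite ?mulr0.
Qed.

Lemma enorm_subvec I u : enorm (subvec I u) = enorm (cproj I u).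
Proof. by rewrite /enorm dotp_subvec. Qed.

Lemma subvec_mulmx I u (H : 'M[R]_n) :
  subvec I (cproj I u *m H) = subvec I u *m submat I H.
Proof.
apply/rowP => j; rewrite !mxE.
rewrite [RHS](eq_bigr (fun k : 'I_#|I| =>
    u 0 (enum_val k) * H (enum_val k) (enum_val j))); last first.
  by move=> k _; rewrite !mxE.
rewrite -(big_enum_val (A := mem I) (fun k => u 0 k * H k (enum_val j))) [RHS]big_mkcond /=.
by apply: eq_bigr => i _; rewrite !mxE; case: ifP; rewrite ?mul0r.
Qed.

Lemma subvec_surj I (q : 'rV[R]_#|I|) : exists v, subvec I v = q.
Proof.
exists (\row_i \sum_(j | enum_val j == i) q 0 j); apply/rowP => j; rewrite !mxE.
rewrite (big_pred1 j)// => k; exact/inj_eq/enum_val_inj.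
Qed.

End EuclideanNorm.

(* [H] is not assumed to be symmetric. *)
Definition psd {R : realType} {n : nat} (H : 'M[R]_n) :=
  forall v : 'rV[R]_n, 0 <= dotp v (v *m H).

Section RegularizedSystem.
Context {R : realType} {n : nat}.
Implicit Types (mu : R) (u v w e : 'rV[R]_n) (H : 'M[R]_n) (I : {set 'I_n}).

(** Pair the equation with [v]: the [H] term is nonnegative, so mu |v|^2 <= <v, e> <= |v| |e|. *)
Lemma psd_shift_coercive I H mu v e : psd H -> 0 < mu ->
  cproj I v = v -> cproj I (v *m H) + mu *: v = e -> mu * enorm v <= enorm e.
Proof.
move=> psdH mu0 vI ve.
have [->|v0] := eqVneq v 0; first by rewrite enorm0 mulr0 enorm_ge0.
rewrite -(ler_pM2r (enorm_gt0 v0)) -mulrA -expr2 sqr_enorm.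
apply: le_trans (dotp_le_enorm _ _); rewrite -ve dotpC dotpDr dotpZr.
by rewrite -dotp_cprojl vI lerDr.
Qed.

(** A row of the kernel is the subvector of some [v], and coercivity with right-hand side 0 makes it
    vanish. *)
Lemma psd_submat_unit I H mu : psd H -> 0 < mu ->
  submat I H + mu%:M \in unitmx.
Proof.
move=> psdH mu0; rewrite -row_free_unit -kermx_eq0; apply/eqP/row_matrixP => i.
rewrite row0; set q := row i _.
have /eqP : q *m (submat I H + mu%:M) = 0.
  by rewrite -row_mul mulmx_ker row0.
have [v <-] := subvec_surj q; rewrite mulmxDr -subvec_mulmx mul_mx_scalar => /eqP vH.
have e0 : cproj I (cproj I v *m H) + mu *: cproj I v = 0.
  have <- : cproj I (cproj I (cproj I v *m H) + mu *: cproj I v) =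
            cproj I (cproj I v *m H) + mu *: cproj I v.
    by rewrite cprojD cprojZ !cproj_id.
  apply: enorm_eq0; rewrite -enorm_subvec.
  have -> : subvec I (cproj I (cproj I v *m H) + mu *: cproj I v) =
     subvec I (cproj I v *m H) + mu *: subvec I v.
    by apply/rowP => j; rewrite !mxE !enum_valP.
  by rewrite vH enorm0.
have := psd_shift_coercive psdH mu0 (cproj_id I v) e0.
rewrite enorm0 pmulr_rle0// => h; apply: enorm_eq0; apply/eqP.
by rewrite enorm_subvec eq_le h enorm_ge0.
Qed.

Lemma direction_cproj I H mu (p g o : 'rV[R]_n) (r : 'rV[R]_#|I|) :
  psd H -> 0 < mu ->
  subvec I p = (subvec I g + subvec I o + r) *m invmx (submat I H + mu%:M) ->
  exists2 r' : 'rV[R]_n, enorm r' = enorm r &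
    cproj I (cproj I p *m H) + mu *: cproj I p = cproj I (g + o) + r'.
Proof.
move=> psdH mu0 pE.
exists (cproj I (cproj I p *m H) + mu *: cproj I p - cproj I (g + o)); last first.
  by rewrite [RHS]addrC subrK.
have rE : r = subvec I p *m (submat I H + mu%:M) - (subvec I g + subvec I o).
  by rewrite pE mulmxKV ?psd_submat_unit// addrAC subrr add0r.
(* The witness is supported in [I], so its norm can be computed on the subvector, which is [r]. *)
rewrite -[X in enorm X](_ : cproj I (cproj I (cproj I p *m H) + mu *: cproj I p - cproj I (g + o)) = _).
  rewrite -enorm_subvec rE mulmxDr -subvec_mulmx mul_mx_scalar; congr enorm.
  by apply/rowP => j; rewrite !mxE !enum_valP.
by rewrite cprojB cprojD cprojZ !cproj_id.
Qed.

End RegularizedSystem.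

(** * Soft thresholding and calculus along lines *)

Section SoftThresholding.
Context {R : realType}.
Implicit Types (a z u : R).

Definition soft a z : R := if a < z then z - a else if z < - a then z + a else 0.

(** Optimality condition of the proximal problem: [z - soft a z] is a subgradient of a|.| at
    [soft a z]. *)
Lemma soft_subgradient a z u : 0 <= a ->
  a * `|soft a z| + (z - soft a z) * (u - soft a z) <= a * `|u|.
Proof.
move=> a0; have hu := ler_norm u; have hNu : - u <= `|u| by rewrite -normrN ler_norm.
rewrite /soft; case: ltP => [az|za].
  by rewrite gtr0_norm ?subr_gt0//; nra.
case: ltP => [zNa|Naz].
  by rewrite ltr0_norm; [nra|lra].
rewrite normr0 !subr0 mulr0 add0r; have [u0|u0] := leP 0 u.
  by rewrite ger0_norm// ler_wpM2r.
by rewrite ltr0_norm//; nra.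
Qed.

Lemma soft_small a z : `|z| <= a -> soft a z = 0.
Proof. by rewrite ler_norml /soft => /andP[h1 h2]; rewrite !ltNge h1 h2. Qed.

Lemma argmin_unique (T : pointedType) (F : T -> R) (u0 : T) :
  (forall v, v <> u0 -> F u0 < F v) -> argmin F = u0.
Proof.
move=> h; rewrite /argmin; apply: get_unique => [v|v hv].
  by have [->//|/eqP/h/ltW] := eqVneq v u0.
by apply: contrapT => /h; rewrite ltNge hv.
Qed.

(** Expanding the squares around [soft a z] reduces this to the subgradient inequality. The extra
    quadratic term makes the minimizer unique, which determines the choice made by [argmin]. *)
Lemma soft_strict_min a z u : 0 <= a ->
  a * `|soft a z| + 2^-1 * (soft a z - z) ^+ 2 + 2^-1 * (u - soft a z) ^+ 2
  <= a * `|u| + 2^-1 * (u - z) ^+ 2.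
Proof.
move=> a0; have := soft_subgradient z u a0; set s := soft a z; nra.
Qed.

Lemma prox_absE a z : 0 <= a -> prox_abs a z = soft a z.
Proof.
move=> a0; apply: argmin_unique => u /eqP us.
apply: lt_le_trans (soft_strict_min z u a0).
by rewrite ltrDl mulr_gt0// exprn_even_gt0//= subr_eq0.
Qed.

Lemma proxE (n : nat) (gamma : R) (z : 'rV[R]_n) : 0 <= gamma ->
  prox 1 (l1reg gamma) z = \row_i soft gamma (z 0 i).
Proof.
move=> g0; set s := \row_i _; apply: argmin_unique => u us.
have us0 : 0 < enorm (u - s).
  by apply: enorm_gt0; rewrite subr_eq0; apply/eqP.
apply: (@lt_le_trans _ _ (1 * l1reg gamma s + 2^-1 * enorm (s - z) ^+ 2 +
   2^-1 * enorm (u - s) ^+ 2)).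
  by rewrite ltrDl mulr_gt0// exprn_gt0.
rewrite /l1reg !mul1r !sqr_enorm !mulr_sumr -!big_split /=.
apply: ler_sum => i _; rewrite !mxE -!expr2.
exact: soft_strict_min.
Qed.

(** The threshold t gamma dominates the shift t g, so the new value lies between 0 and [x]. *)
Lemma soft_step_shrinks (gamma t x g : R) : 0 < t -> `|g| <= gamma ->
  `|soft (t * gamma) (x - t * g) - x| <= `|x|.
Proof.
move=> t0; rewrite ler_norml => /andP[g1 g2].
have h1 : t * g <= t * gamma by rewrite ler_pM2l.
have h2 : - (t * gamma) <= t * g by rewrite -mulrN ler_pM2l.
rewrite /soft; case: ltP => [|_]; last case: ltP => [|_].
- by move=> h; rewrite ler_norml; have [x0|x0] := leP 0 x;
    [rewrite ger0_norm//|rewrite ltr0_norm//]; lra.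
- by move=> h; rewrite ler_norml; have [x0|x0] := leP 0 x;
    [rewrite ger0_norm//|rewrite ltr0_norm//]; lra.
- by rewrite sub0r normrN.
Qed.

End SoftThresholding.

(** * Mean values along segments, the gradient inequality and the positive semidefinite Hessian *)

Section LineCalculus.
Context {R : realType} {n : nat}.
Implicit Types (u v w x y : 'rV[R]_n) (s : R).

Lemma dotp_continuous w : continuous (dotp w).
Proof.
apply: (@continuous_big R _ +%R 0 xpredT (@add_continuous R) _ _
  (fun i v => w 0 i * v 0 i)) => i _ x.
exact: (@cvgMl_tmp R _ (nbhs x) (nbhs_filter x) _ _ _ (@coord_continuous R 1 n 0 i x)).
Qed.

Lemma derive_quotient_line (W : normedModType R) (G : 'rV[R]_n -> W) x v s h :
  G (x + (h *: 1 + s) *: v) = G (h *: v + (x + s *: v)).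
Proof. by congr G; rewrite scalerDl /GRing.scale/= mulr1 addrCA. Qed.

Lemma is_derive_line (f : 'rV[R]_n -> R) x v s :
  differentiable f (x + s *: v) ->
  is_derive s 1 (fun s => f (x + s *: v)) ('D_v f (x + s *: v)).
Proof.
move=> df; have dv := @diff_derivable _ _ _ f (x + s *: v) v df.
have E : (fun h : R => h^-1 *: (f (x + (h *: 1 + s) *: v) - f (x + s *: v))) =
         (fun h : R => h^-1 *: (f (h *: v + (x + s *: v)) - f (x + s *: v))).
  by apply/funext => h; rewrite (derive_quotient_line f x v s h).
split; first by rewrite /derivable /= E.
by rewrite /derive /= E.
Qed.

Lemma is_derive_dotp_line (G : 'rV[R]_n -> 'rV[R]_n) w x v s :
  differentiable G (x + s *: v) ->
  is_derive s 1 (fun s => dotp w (G (x + s *: v)))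
    (dotp w (v *m 'J G (x + s *: v))).
Proof.
move=> dG; have dv := @diff_derivable _ _ _ G (x + s *: v) v dG.
rewrite -deriveEjacobian//.
have E : (fun h : R => h^-1 *: (dotp w (G (x + (h *: 1 + s) *: v)) - dotp w (G (x + s *: v)))) =
         (fun h : R => dotp w (h^-1 *: (G (h *: v + (x + s *: v)) - G (x + s *: v)))).
  apply/funext => h; rewrite (derive_quotient_line (W := 'rV[R]_n) G x v s h).
  by rewrite dotpZr dotpBr.
have cv : (fun h : R => h^-1 *: (dotp w (G (x + (h *: 1 + s) *: v)) - dotp w (G (x + s *: v)))) @ 0^' -->
   dotp w ('D_v G (x + s *: v)).
  by rewrite E; apply: continuous_cvg; [exact: dotp_continuous|exact: dv].
split; first by apply/cvg_ex; exists (dotp w ('D_v G (x + s *: v))).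
by rewrite /derive /=; apply: cvg_lim => //.
Qed.

Lemma MVT_unit (phi dphi : R -> R) :
  (forall s, is_derive s (1 : R) phi (dphi s)) ->
  exists c, [/\ 0 <= c, c <= 1 & phi 1 - phi 0 = dphi c].
Proof.
move=> d.
have [|c] := @MVT_segment R phi dphi 0 1 ler01 (fun s _ => d s).
  apply: continuous_subspaceT => s; apply: differentiable_continuous.
  by apply/derivable1_diffP; case: (d s).
by rewrite in_itv/= => /andP[c0 c1]; rewrite subr0 mulr1 => ->; exists c.
Qed.

Lemma derive_grad (f : 'rV[R]_n -> R) x v : differentiable f x ->
  'D_v f x = dotp (grad f x) v.
Proof.
move=> df; rewrite deriveE// {1}[v]matrix_sum_delta big_ord1 linear_sum /=.
apply: eq_bigr => i _; rewrite linearZ/= mxE deriveE// mulrC.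
by [].
Qed.

Variable f : 'rV[R]_n -> R.
Hypothesis f2 : twice_cont_diff f.

Lemma grad_continuous : continuous (grad f).
Proof. by case: f2 => _ + _ x => /(_ x)/differentiable_continuous. Qed.

Lemma MVT_along x v : exists c, [/\ 0 <= c, c <= 1 &
  f (x + v) - f x = dotp (grad f (x + c *: v)) v].
Proof.
have [fd _ _] := f2.
have [|c [c0 c1]] := @MVT_unit (fun s => f (x + s *: v))
    (fun s => dotp (grad f (x + s *: v)) v).
  by move=> s; rewrite -derive_grad//; apply: is_derive_line.
by rewrite scale1r scale0r addr0 => E; exists c.
Qed.

(** A vector-valued map has no mean value equality, so the gradient is tested against a fixed [w],
    on which the intermediate point depends. *)
Lemma MVT_grad_along w x v : exists c, [/\ 0 <= c, c <= 1 &
  dotp w (grad f (x + v) - grad f x) = dotp w (v *m hess f (x + c *: v))].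
Proof.
have [_ gd _] := f2.
have [|c [c0 c1]] := @MVT_unit (fun s => dotp w (grad f (x + s *: v)))
    (fun s => dotp w (v *m hess f (x + s *: v))).
  by move=> s; apply: is_derive_dotp_line.
by rewrite scale1r scale0r addr0 -dotpBr => E; exists c.
Qed.

Hypothesis fconvex : convex_function [set: 'rV[R]_n] f.

Lemma convex_line x v s : 0 < s -> s <= 1 ->
  f (x + s *: v) - f x <= s * (f (x + v) - f x).
Proof.
move=> s0 s1; rewrite lerBlDr.
have h : f (s *: (x + v) + (1 - s) *: x) <= s * f (x + v) + (1 - s) * f x.
  exact: (@fconvex (Itv01 (ltW s0) s1) _ _ (in_setT _) (in_setT _)).
rewrite scalerDr scalerBl scale1r addrAC addrCA subrr addr0 in h.
by apply: le_trans h _; rewrite le_eqVlt; apply/orP; left; apply/eqP; ring.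
Qed.

Lemma small_step v r : 0 < r -> exists s, [/\ 0 < s, s <= 1 &
  forall c, 0 <= c -> c <= 1 -> enorm (c *: (s *: v)) < r].
Proof.
move=> r0; have e0 := enorm_ge0 v.
(* The added 1 covers [v = 0] and makes the bound strict. *)
exists (Num.min 1 (r / (enorm v + 1))); split.
- by rewrite lt_min ltr01 divr_gt0//; lra.
- by rewrite ge_min lexx.
move=> c c0 c1; rewrite !enormZ (ger0_norm c0).
have s0 : 0 < Num.min 1 (r / (enorm v + 1)) by rewrite lt_min ltr01 divr_gt0//; lra.
rewrite (ger0_norm (ltW s0)).
have : Num.min 1 (r / (enorm v + 1)) * (enorm v + 1) <= r.
  by rewrite -ler_pdivlMr ?ge_min ?lexx ?orbT//; lra.
move: s0; set s := Num.min _ _ => s0 h.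
have : c * (s * enorm v) <= 1 * (s * enorm v) by rewrite ler_wpM2r// mulr_ge0// ltW.
nra.
Qed.

(** Otherwise, by continuity, the slope along [v] exceeds f(x+v) - f(x) on a whole ball, and the
    mean value theorem on a short step [s *: v] contradicts the chord inequality [convex_line]. *)
Lemma convex_grad_le x v : dotp (grad f x) v <= f (x + v) - f x.
Proof.
rewrite leNgt; apply/negP => h.
have cont : (fun y => dotp v (grad f y)) @ x --> dotp v (grad f x).
  exact: (@continuous_cvg _ _ _ _ _ _ (dotp v) _ (@dotp_continuous v _) (@grad_continuous x)).
rewrite dotpC in h.
have [r r0 hr] := near_eball (cvgr_gt _ cont _ h).
have [s [s0 s1 hs]] := small_step v r0.
have [c [c0 c1]] := MVT_along x (s *: v).
have := hr (x + c *: (s *: v)); rewrite addrAC subrr add0r => /(_ (hs _ c0 c1)).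
rewrite dotpC dotpZr => h1 h2.
have := convex_line x v s0 s1; rewrite h2 ler_pM2l//.
by rewrite leNgt h1.
Qed.

Lemma grad_monotone x v : 0 <= dotp v (grad f (x + v) - grad f x).
Proof.
have h1 := convex_grad_le x v; have := convex_grad_le (x + v) (- v).
rewrite addrK dotpNr dotpBr !(dotpC v); lra.
Qed.

Lemma hess_form_continuous v w : continuous (fun y => dotp w (v *m hess f y)).
Proof.
have [_ _ hc] := f2.
have -> : (fun y => dotp w (v *m hess f y)) =
          (fun y => \sum_i w 0 i * \sum_j v 0 j * hess f y j i).
  by apply/funext => y; apply: eq_bigr => i _; rewrite mxE.
apply: (@continuous_big R _ +%R 0 xpredT (@add_continuous R) _ _
  (fun i y => w 0 i * \sum_j v 0 j * hess f y j i)) => i _ x.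
apply: (@cvgMl_tmp R _ (nbhs x) (nbhs_filter x)).
apply: (@cvg_big R _ +%R 0 xpredT (@add_continuous R) _ _ _
  (fun j y => v 0 j * hess f y j i)) => j _.
apply: (@cvgMl_tmp R _ (nbhs x) (nbhs_filter x)).
exact: (@continuous_cvg _ _ _ _ _ _ (fun A : 'M[R]_n => A j i) _ (@coord_continuous R n n j i _) (hc x)).
Qed.

(** A negative value of the form would persist near [x]; the mean value theorem for the gradient on
    a short step then contradicts monotonicity. *)
Lemma hess_psd x : psd (hess f x).
Proof.
move=> v; rewrite leNgt; apply/negP => h.
have [r r0 hr] := near_eball (cvgr_lt _ (@hess_form_continuous v v x) _ h).
have [s [s0 s1 hs]] := small_step v r0.
have [c [c0 c1]] := MVT_grad_along v x (s *: v).
have := hr (x + c *: (s *: v)); rewrite addrAC subrr add0r => /(_ (hs _ c0 c1)).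
rewrite -scalemxAl dotpZr => h1 h2.
have := grad_monotone x (s *: v); rewrite dotpZl h2 pmulr_rge0// pmulr_rge0//.
by rewrite leNgt h1.
Qed.

End LineCalculus.

(** * Local structure at the limit point *)

Section LocalRegularity.
Context {R : realType} {n : nat}.
Variables (f : 'rV[R]_n -> R) (gamma : R) (xs : 'rV[R]_n).
Implicit Types (x y z v : 'rV[R]_n).

Definition supp : {set 'I_n} := [set i | xs 0 i != 0].

(* On [active_manifold xs] near [xs] this is the gradient of [psi]; near [xs]
   it coincides with the proximal residual. *)
Definition local_residual x : 'rV[R]_n :=
  \row_i (if xs 0 i == 0 then x 0 i else grad f x 0 i + gamma * Num.sg (xs 0 i)).

Lemma supp_cproj x : active_manifold xs x <-> cproj supp x = x.
Proof.
split=> [xM|xE i xsi].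
  apply/rowP => i; rewrite !mxE inE; case: eqP => //= /xM ->; by [].
by rewrite -xE mxE inE xsi eqxx.
Qed.

Lemma affine_hull_line (S : set 'rV[R]_n) z q1 q2 s :
  S z -> S q1 -> S q2 -> affine_hull S (z + s *: (q1 - q2)).
Proof.
move=> Sz S1 S2.
exists 3%N, (fun i : 'I_3 => [:: 1; s; - s]`_i), (fun i : 'I_3 => [:: z; q1; q2]`_i).
split.
- by case; case=> [|[|[|]]].
- by rewrite !big_ord_recl big_ord0 /= addr0 addrN addr0.
- rewrite !big_ord_recl big_ord0 /= scale1r addr0 scalerBr scaleNr.
  by [].
Qed.

Lemma l1reg_line x i s :
  l1reg gamma (x + s *: delta_mx 0 i) = l1reg gamma x + gamma * (`|x 0 i + s| - `|x 0 i|).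
Proof.
rewrite /l1reg -mulrDr; congr (_ * _).
rewrite (bigD1 i)//= [in RHS](bigD1 i)//= !mxE !eqxx mulr1.
rewrite [RHS]addrC addrA subrK; congr (_ + _).
by apply: eq_bigr => j ji; rewrite !mxE (negbTE ji) andbF mulr0 addr0.
Qed.

Lemma dotp_delta v i : dotp v (delta_mx 0 i) = v 0 i.
Proof.
rewrite /dotp (bigD1 i)//= big1 ?addr0; first by rewrite mxE !eqxx mulr1.
by move=> j ji; rewrite mxE (negbTE ji) andbF mulr0.
Qed.

Hypothesis gamma0 : 0 < gamma.

Lemma subdiff_l1reg_le x v i : subdiff (l1reg gamma) x v -> `|v 0 i| <= gamma.
Proof.
move=> sv.
have key s : s * v 0 i <= gamma * `|s|.
  have := sv (x + s *: delta_mx 0 i); rewrite l1reg_line [_ + _ - x]addrC addKr.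
  rewrite dotpZr dotp_delta lerD2l => /le_trans; apply.
  by rewrite ler_pM2l// lerBlDl ler_normD.
have := key 1; have := key (-1); rewrite normrN1 normr1 ler_norml => *.
by apply/andP; split; lra.
Qed.

(** The regularizer is separable: testing [v] at [y] with its entry [i] set to 0 removes that
    coordinate, and c y_i <= gamma |y_i| puts it back with the new slope. *)
Lemma subdiff_l1reg_zero_coord x v i c : subdiff (l1reg gamma) x v -> x 0 i = 0 ->
  `|c| <= gamma -> subdiff (l1reg gamma) x (v + (c - v 0 i) *: delta_mx 0 i).
Proof.
move=> sv xi0 cg y /=.
have := sv (y + (- y 0 i) *: delta_mx 0 i).
have -> : y + - y 0 i *: delta_mx 0 i - x = (y - x) + - y 0 i *: delta_mx 0 i.
  by rewrite addrAC.
rewrite l1reg_line subrr normr0 dotpDr dotpZr dotp_delta.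
have -> : dotp (v + (c - v 0 i) *: delta_mx 0 i) (y - x) =
    dotp v (y - x) + (c - v 0 i) * y 0 i.
  by rewrite dotpDl dotpZl [dotp (delta_mx 0 i) _]dotpC dotp_delta !mxE xi0 subr0.
have : c * y 0 i <= gamma * `|y 0 i|.
  by apply: le_trans (ler_norm _) _; rewrite normrM ler_wpM2r.
lra.
Qed.

(** Entry [i] of a subgradient ranges over [-gamma, gamma], so the affine hull contains the whole
    line through 0 along [e]. Relative interiority puts both s e and -s e in the set, which gives
    |(grad f xs)_i| <= gamma - s. *)
Lemma strict_complementarity_grad : strict_complementarity f gamma xs ->
  forall i, xs 0 i = 0 -> `|grad f xs 0 i| < gamma.
Proof.
move=> [[v sv gv] [r r0 rS]] i xi0.
set S := [set _ | _ in _] in rS.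
have vE : v = - grad f xs by apply/eqP; rewrite -addr_eq0 addrC gv.
have v0S : S 0 by exists v.
pose e : 'rV[R]_n := delta_mx 0 i.
have qS c : `|c| <= gamma -> S ((c + grad f xs 0 i) *: e).
  move=> cg; exists (v + (c - v 0 i) *: e); first exact: subdiff_l1reg_zero_coord.
  by rewrite addrA gv add0r vE !mxE opprK.
have eS s : enorm (s *: e) < r -> S (s *: e).
  move=> sr; apply: rS; split; first by rewrite /eball /= subr0.
  have g1 : `|gamma| <= gamma by rewrite gtr0_norm.
  have g2 : `|- gamma| <= gamma by rewrite normrN.
  (* The points for c = gamma and c = -gamma differ by 2 gamma e, hence the coefficient. *)
  have := affine_hull_line (s / (2 * gamma)) v0S (qS _ g1) (qS _ g2).
  rewrite add0r -scalerBl scalerA (_ : _ * _ = s)//; field.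
  by rewrite gt_eqF.
have ei : e 0 i = 1 by rewrite mxE !eqxx.
have key s : enorm (s *: e) < r -> `|s - grad f xs 0 i| <= gamma.
  move=> /eS[w sw we]; have := subdiff_l1reg_le i sw.
  have := congr1 (fun u : 'rV[R]_n => u 0 i) we.
  rewrite [LHS]mxE [RHS]mxE ei mulr1 => <-.
  by rewrite [_ + w 0 i]addrC addrK.
have [s [s0 s1 hs]] := small_step e r0.
have := hs 1 ler01 (lexx _); rewrite scale1r => hs1.
have hN : enorm ((- s) *: e) < r by rewrite scaleNr enormN.
have := key _ hs1; have := key _ hN; rewrite !ler_norml ltr_norml.
by move=> /andP[? ?] /andP[? ?]; apply/andP; split; lra.
Qed.

Hypothesis f2 : twice_cont_diff f.

Lemma grad_coord_continuous i : continuous (fun y => grad f y 0 i).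
Proof.
move=> x; exact: (@continuous_cvg _ _ _ _ _ _ (fun v : 'rV[R]_n => v 0 i) _
  (@coord_continuous R 1 n 0 i _) (@grad_continuous _ _ _ f2 x)).
Qed.

(** If the sum [e] were nonzero, moving coordinate [i] slightly in the direction [- e], without
    changing its sign, would decrease psi. *)
Lemma minimizer_stationary z i : minimizers (psi f gamma) z -> z 0 i != 0 ->
  grad f z 0 i + gamma * Num.sg (z 0 i) = 0.
Proof.
move=> zmin zi; set b := gamma * _; apply/eqP/negPn/negP => e0.
set e := grad f z 0 i + b in e0.
have cont : (fun y => e * grad f y 0 i) @ z --> e * grad f z 0 i.
  apply: (@cvgMl_tmp R _ (nbhs z) (nbhs_filter z)).
  exact: (@grad_coord_continuous i z).
have ee : 0 < e * e by rewrite -expr2 exprn_even_gt0.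
have ee' : - (e * b) < e * grad f z 0 i.
  by move: ee; rewrite {2}/e mulrDr; lra.
have [r r0 hr] := near_eball (cvgr_gt _ cont _ ee').
(* Steps shorter than |z_i| keep the sign, so the absolute value is linear along them. *)
have r1 : 0 < Num.min r `|z 0 i| by rewrite lt_min r0 normr_gt0.
have [s [s0 s1 hs]] := small_step (- e *: delta_mx 0 i) r1.
have dE : s *: (- e *: delta_mx 0 i) = (s * - e) *: delta_mx 0 i :> 'rV[R]_n.
  by rewrite scalerA.
rewrite dE in hs; have [c [c0 c1]] := MVT_along f2 z ((s * - e) *: delta_mx 0 i).
rewrite dotpZr dotp_delta => fE.
have := hs _ c0 c1; rewrite lt_min => /andP[hs1 _].
have := hr (z + c *: ((s * - e) *: delta_mx 0 i)).
rewrite [X in enorm X]addrAC subrr add0r => /(_ hs1) h.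
have := hs 1 ler01 (lexx _); rewrite scale1r lt_min => /andP[_ hs2].
have hse : `|s * - e| < `|z 0 i|.
  apply: le_lt_trans hs2.
  by have := le_abs_enorm ((s * - e) *: delta_mx 0 i : 'rV[R]_n) i; rewrite !mxE !eqxx mulr1.
have := zmin (z + (s * - e) *: delta_mx 0 i); rewrite /psi l1reg_line.
have -> : `|z 0 i + s * - e| = `|z 0 i| + Num.sg (z 0 i) * (s * - e).
  move: hse; rewrite ltr_norml => /andP[]; have [z0|z0|/eqP] := ltgtP (z 0 i) 0; last by rewrite (negbTE zi).
    by rewrite ltr0_norm// ltr0_sg// => ? ?; rewrite ltr0_norm; lra.
  by rewrite gtr0_norm// gtr0_sg// => ? ?; rewrite gtr0_norm; lra.
move: h fE; set g := grad f _ 0 i => h fE zle.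
have : s * (e * g + e * b) <= 0 by rewrite /b; lra.
by rewrite pmulr_rle0//; lra.
Qed.

Lemma minimizer_local_residual : minimizers (psi f gamma) xs -> local_residual xs = 0.
Proof.
move=> xsmin; apply/rowP => i; rewrite [LHS]mxE [RHS]mxE; case: eqVneq => // xi.
exact: minimizer_stationary.
Qed.

Lemma proj_active_manifold v :
  orthogonal_projection (active_manifold xs) v = cproj supp v.
Proof.
apply: get_unique => [|w [wM hw]].
  split=> [|z zM]; first by apply/supp_cproj; rewrite cproj_id.
  by rewrite -((supp_cproj z).1 zM) -dotp_cprojl cprojB cproj_id subrr dotpC dotp0r.
(* The two candidate projections differ by a vector of the subspace, which turns out to be
   orthogonal to itself. *)
have : dotp (v - w) (cproj supp v - w) = 0.
  by apply: hw; apply/supp_cproj; rewrite cprojB cproj_id (supp_cproj w).1.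
rewrite -{2}((supp_cproj w).1 wM) -cprojB -(cproj_id _ (v - w)) -dotp_cprojl.
rewrite -sqr_enorm => /eqP; rewrite sqrf_eq0 => /eqP/enorm_eq0.
by rewrite cprojB ((supp_cproj w).1 wM) => /eqP; rewrite subr_eq0 => /eqP ->.
Qed.

Lemma hess_manifold_diffE x y v :
  hess_manifold f xs x v - hess_manifold f xs y v =
  cproj supp (v *m (hess f x - hess f y)).
Proof.
by rewrite mulmxBr cprojB; congr (_ - _); exact: proj_active_manifold.
Qed.

(** The supremum in [opnorm_on] dominates its set only once that set is known to be bounded
    above. *)
Lemma cproj_mulmx_bound (H : 'M[R]_n) : exists B, forall v, enorm v <= 1 ->
  enorm (cproj supp (v *m H)) <= B.
Proof.
exists (\sum_j \sum_k `|H k j|) => v v1.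
apply: le_trans (enorm_cproj _ _) _; apply: le_trans (enorm_le_sum _) _.
apply: ler_sum => j _; rewrite mxE; apply: le_trans (ler_norm_sum _ _ _) _.
apply: ler_sum => k _; rewrite normrM; apply: ler_piMl => //.
exact: le_trans (le_abs_enorm _ _) v1.
Qed.

Lemma lipschitz_hessian_cproj : lipschitz_hessian f xs ->
  exists b L, [/\ 0 < b, 0 <= L & forall x y v,
    enorm (x - xs) < b -> enorm (y - xs) < b ->
    active_manifold xs x -> active_manifold xs y -> active_manifold xs v ->
    enorm (cproj supp (v *m (hess f x - hess f y))) <= L * enorm (x - y) * enorm v].
Proof.
move=> [b b0 [L hL]]; exists b, `|L|; split=> // x y v xb yb xM yM vM.
have [->|v0] := eqVneq v 0.
  rewrite mul0mx enorm0 mulr0 -(scale0r (0 : 'rV[R]_n)) cprojZ scale0r enorm0.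
  by [].
have nv := enorm_gt0 v0.
have := hL x y (conj xb xM) (conj yb yM); rewrite /opnorm_on.
set S := [set _ | _ in _] => hS.
have SE w : active_manifold xs w -> enorm w <= 1 ->
    S (enorm (cproj supp (w *m (hess f x - hess f y)))).
  move=> wM w1; exists w => //; congr enorm.
  exact: hess_manifold_diffE.
have [B hB] := cproj_mulmx_bound (hess f x - hess f y).
have supS : has_sup S.
  split.
    exists (enorm (cproj supp (0 *m (hess f x - hess f y)))); apply: SE.
      by move=> i _; rewrite mxE.
    by rewrite enorm0.
  exists B => _ [w [wM w1] <-].
  by rewrite hess_manifold_diffE; apply: hB.
pose w := (enorm v)^-1 *: v.
have wM : active_manifold xs w by move=> i /vM; rewrite mxE => ->; rewrite mulr0.
have w1 : enorm w <= 1.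
  by rewrite enormZ ger0_norm ?invr_ge0 ?enorm_ge0// mulVf// gt_eqF.
have := le_trans (ub_le_sup supS.2 (SE w wM w1)) hS.
rewrite /w -scalemxAl cprojZ enormZ ger0_norm ?invr_ge0 ?enorm_ge0// mulrC ler_pdivrMr//.
move=> /le_trans; apply; rewrite ler_wpM2r ?enorm_ge0// ler_wpM2r ?enorm_ge0//.
exact: ler_norm.
Qed.

End LocalRegularity.

Lemma uniform_lower_bound {R : realType} {n : nat} (F : 'I_n -> R) :
  exists2 a, 0 < a & forall i, 0 < F i -> a <= F i.
Proof.
have S0 : 0 <= \sum_i `|F i|^-1 by apply: sumr_ge0 => i _; rewrite invr_ge0.
(* The inverse of a sum of inverses lies below each positive entry. Zero entries contribute 0, and
   the leading 1 keeps the witness positive when the sum is 0. *)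
exists (1 + \sum_i `|F i|^-1)^-1; first by rewrite invr_gt0; lra.
move=> i Fi; rewrite -[leRHS]invrK lef_pV2 ?posrE ?invr_gt0//; last lra.
rewrite (bigD1 i)//= gtr0_norm//.
have : 0 <= \sum_(j < n | j != i) `|F j|^-1 by apply: sumr_ge0 => j _; rewrite invr_ge0.
lra.
Qed.

(* All that is used of the problem data on the ball of radius [r] about [xs]. *)
Record regular_at {R : realType} {n : nat} (f : 'rV[R]_n -> R) (gamma : R)
    (eps : R) (xs : 'rV[R]_n) (r a eta L c1 : R) : Prop := RegularAt {
  reg_pos : [/\ 0 < r, 0 < a, 0 < eta, 0 <= L & 0 < c1];
  reg_sign : forall (x : 'rV[R]_n) i, enorm (x - xs) < r -> xs 0 i != 0 ->
    a <= x 0 i * Num.sg (xs 0 i);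
  reg_small : forall (x : 'rV[R]_n) i, enorm (x - xs) < r -> xs 0 i = 0 ->
    `|x 0 i| <= eta /\ `|x 0 i| <= eps;
  reg_grad : forall (x : 'rV[R]_n) i, enorm (x - xs) < r -> xs 0 i = 0 ->
    `|grad f x 0 i| <= gamma - eta;
  reg_lip : forall x y : 'rV[R]_n, enorm (x - xs) < r -> enorm (y - xs) < r ->
    enorm (grad f x - grad f y) <= L * enorm (x - y);
  reg_hess : forall x y v : 'rV[R]_n, enorm (x - xs) < r -> enorm (y - xs) < r ->
    active_manifold xs x -> active_manifold xs y -> active_manifold xs v ->
    enorm (cproj (supp xs) (v *m (hess f x - hess f y)))
    <= L * enorm (x - y) * enorm v;
  reg_eb : forall x : 'rV[R]_n, enorm (x - xs) < r ->
    Defs.edist x (minimizers (psi f gamma)) <= c1 * enorm (prox_residual f gamma x)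
}.

Lemma regular_at_limit {R : realType} {n : nat} (f : 'rV[R]_n -> R) (gamma : R)
    (eps Lg : R) (U : set 'rV[R]_n) (xs : 'rV[R]_n) :
  0 < gamma -> 0 < eps -> open U -> U xs -> elipschitz_on Lg U (grad f) ->
  strict_complementarity f gamma xs -> error_bound f gamma xs ->
  lipschitz_hessian f xs ->
  exists r a eta L c1, regular_at f gamma eps xs r a eta L c1.
Proof.
move=> g0 e0 oU Uxs lipU sc [b1 [c1 [b10 c10 eb]]] lh.
have [b2 [L2 [b20 L20 lh2]]] := lipschitz_hessian_cproj lh.
have [b3 b30 bU] := (nbhs_enormP xs U).1 (open_nbhs_nbhs (conj oU Uxs)).
(* Half of the nonzero moduli: moving by less than [a] leaves each such entry its sign and a modulus
   of at least [a]. *)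
have [a a0 aP] := uniform_lower_bound (fun i => `|xs 0 i| / 2).
(* Half of the complementarity gap is kept as the margin [eta]; the other half absorbs the variation
   of the gradient, which the radius eta / (L + 1) limits to [eta]. *)
have [eta eta0 etaP] := uniform_lower_bound (fun i => (gamma - `|grad f xs 0 i|) / 2).
pose L := Num.max `|Lg| L2.
have L0 : 0 <= L by rewrite le_max normr_ge0.
have L10 : 0 < eta / (L + 1) by rewrite divr_gt0//; lra.
pose r := \big[Num.min/a]_(z <- [:: b1; b2; b3; eta; eps; eta / (L + 1)]) z.
have rE z : enorm (z - xs) < r -> [/\ enorm (z - xs) < b1, enorm (z - xs) < b2,
    enorm (z - xs) < b3, enorm (z - xs) < a & [/\ enorm (z - xs) < eta,
    enorm (z - xs) < eps & enorm (z - xs) < eta / (L + 1)]].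
  by rewrite /r !big_cons big_nil !lt_min => /and5P[? ? ? ? /and3P[]].
have lipL x y : enorm (x - xs) < r -> enorm (y - xs) < r ->
    enorm (grad f x - grad f y) <= L * enorm (x - y).
  move=> /rE[_ _ xU _ _] /rE[_ _ yU _ _].
  apply: le_trans (lipU _ _ (bU _ xU) (bU _ yU)) _.
  rewrite ler_wpM2r ?enorm_ge0//; apply: le_trans (ler_norm _) _.
  by rewrite le_max lexx.
have r0 : 0 < r by rewrite /r !big_cons big_nil !lt_min b10 b20 b30 eta0 e0 L10 a0.
exists r, a, eta, L, c1; split => //.
- move=> x i /rE[_ _ _ xa _] xi.
  have := aP i; rewrite divr_gt0 ?normr_gt0// => /(_ isT).
  have := le_lt_trans (le_abs_enorm (x - xs) i) xa; rewrite !mxE ltr_norml => /andP[].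
  have [z0|z0|/eqP] := ltgtP (xs 0 i) 0; last by rewrite (negbTE xi).
    by rewrite ltr0_sg// ltr0_norm//; lra.
  by rewrite gtr0_sg// gtr0_norm//; lra.
- move=> x i /rE[_ _ _ _ [xeta xeps _]] xi.
  have := le_abs_enorm (x - xs) i; rewrite !mxE xi subr0 => h.
  by split; apply: ltW; apply: le_lt_trans h _.
- move=> x i xr xi; have [_ _ _ _ [_ _ xL]] := rE _ xr.
  have hsc : 0 < (gamma - `|grad f xs 0 i|) / 2.
    by rewrite divr_gt0// subr_gt0; exact: strict_complementarity_grad.
  have := etaP i hsc.
  have xsr : enorm (xs - xs) < r by rewrite subrr enorm0.
  have h1 := le_trans (le_abs_enorm (grad f x - grad f xs) i) (lipL _ _ xr xsr).
  have h2 : L * enorm (x - xs) <= eta.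
    rewrite ltr_pdivlMr in xL; last lra.
    have := enorm_ge0 (x - xs); nra.
  rewrite [X in `|X| <= _]mxE [X in _ + X]mxE in h1.
  have := ler_distD 0 (grad f x 0 i) 0; rewrite !subr0.
  have := ler_normD (grad f x 0 i - grad f xs 0 i) (grad f xs 0 i); rewrite subrK.
  lra.
- move=> x y v /rE[_ xb _ _ _] /rE[_ yb _ _ _] xM yM vM.
  apply: le_trans (lh2 _ _ _ xb yb xM yM vM) _.
  rewrite ler_wpM2r ?enorm_ge0// ler_wpM2r ?enorm_ge0//.
  by rewrite le_max lexx orbT.
- by move=> x /rE[xb _ _ _ _]; apply: eb.
Qed.

(** * Residual, index sets, direction and trial points near the limit point *)

Section Identification.
Context {R : realType} {n : nat}.
Variables (f : 'rV[R]_n -> R) (gamma : R) (P : tmap_params R) (xs : 'rV[R]_n).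
Variables r a eta L c1 : R.
Hypotheses (f2 : twice_cont_diff f)
  (fconvex : convex_function [set: 'rV[R]_n] f) (gamma0 : 0 < gamma)
  (Pvalid : valid_params P) (xsmin : minimizers (psi f gamma) xs)
  (reg : regular_at f gamma (tm_eps P) xs r a eta L c1).
Implicit Types (x y z v p : 'rV[R]_n).

Let r0 : 0 < r. Proof. by case: (reg_pos reg). Qed.
Let a0 : 0 < a. Proof. by case: (reg_pos reg). Qed.
Let eta0 : 0 < eta. Proof. by case: (reg_pos reg). Qed.
Let eps0 : 0 < tm_eps P. Proof. by case: Pvalid. Qed.

Local Notation res := (local_residual f gamma xs).
Local Notation D := (supp xs).
Local Notation B x := (enorm (x - xs) < r).
Local Notation g := (grad f).

Definition sign_shift : 'rV[R]_n := \row_i (gamma * Num.sg (xs 0 i)).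

Lemma in_supp i : (i \in D) = (xs 0 i != 0).
Proof. by rewrite inE. Qed.

Lemma xs_in_ball : B xs.
Proof. by rewrite subrr enorm0. Qed.

(** Off [D], |x_i - g_i| <= eta + (gamma - eta), so thresholding gives 0. On [D], |res_i| < a <=
    |x_i| keeps x_i - g_i beyond the threshold, on the side of the sign of xs_i. *)
Lemma prox_residual_local x : B x -> enorm (res x) < a ->
  prox_residual f gamma x = res x.
Proof.
have g0 := gamma0.
move=> xB xa; rewrite /prox_residual proxE ?ltW//.
apply/rowP => i; rewrite [LHS]mxE [in LHS]mxE [X in _ - X]mxE [X in soft _ X]mxE [X in soft _ (_ + X)]mxE.
have := le_lt_trans (le_abs_enorm (res x) i) xa; rewrite [RHS]mxE mxE.
case: eqVneq => [xi _|xi].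
  rewrite soft_small ?subr0//.
  have [h1 _] := reg_small reg xB xi; have h2 := reg_grad reg xB xi.
  by apply: le_trans (ler_normB _ _) _; lra.
have := reg_sign reg xB xi; set gi := g x 0 i.
rewrite /soft ltr_norml => h /andP[].
have [z0|z0|/eqP] := ltgtP (xs 0 i) 0; last by rewrite (negbTE xi).
  move: h; rewrite ltr0_sg// => h h1 h2.
  case: ltP => h3; first by exfalso; lra.
  by case: ltP => h4; [lra|exfalso; lra].
move: h; rewrite gtr0_sg// => h h1 h2.
by case: ltP => h3; [lra|exfalso; lra].
Qed.

(** The adaptive threshold separates the two groups: |x_i| <= [eps_at] off [D], where the gradient
    tests also fail, and [eps_at] < a <= |x_i| on [D]. *)
Lemma index_sets x : B x -> enorm (res x) < a ->
  I_mp f gamma P x = [set i | 0 < xs 0 i]%SET /\ I_mm f gamma P x = [set i | xs 0 i < 0]%SET.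
Proof.
have g0 := gamma0; have apos := a0; have etapos := eta0.
move=> xB xa.
have epsE : eps_at f gamma P x = Num.min (tm_eps P) (enorm (res x)).
  by rewrite /eps_at prox_residual_local.
have e0 : 0 <= eps_at f gamma P x by rewrite epsE le_min (ltW eps0) enorm_ge0.
have ea : eps_at f gamma P x < a by rewrite epsE gt_min xa orbT.
have small i : xs 0 i = 0 -> `|x 0 i| <= eps_at f gamma P x.
  move=> xi; rewrite epsE le_min (reg_small reg xB xi).2.
  by have := le_abs_enorm (res x) i; rewrite mxE xi eqxx.
have zero i : xs 0 i = 0 -> [/\ - eps_at f gamma P x <= x 0 i, x 0 i <= eps_at f gamma P x,
    - gamma < g x 0 i & g x 0 i < gamma].
  move=> xi; have := small _ xi; have := reg_grad reg xB xi.
  by rewrite !ler_norml => /andP[? ?] /andP[? ?]; split; lra.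
split; apply/setP => i; rewrite !inE.
- have [z0|z0|z0] := ltgtP 0 (xs 0 i).
  + have := reg_sign reg xB (lt0r_neq0 z0); rewrite gtr0_sg// mulr1 => h.
    by rewrite (lt_le_trans ea h).
  + have := reg_sign reg xB (ltr0_neq0 z0); rewrite ltr0_sg// mulrN1 => h.
    by apply/negbTE; rewrite negb_or -leNgt !negb_and -!ltNge; apply/andP; split; [|apply/orP; left]; lra.
  + have [h1 h2 h3 h4] := zero i (esym z0).
    by rewrite [_ < x 0 i]ltNge h2 [_ <= - gamma]leNgt h3 !andbF.
- have [z0|z0|z0] := ltgtP (xs 0 i) 0.
  + have := reg_sign reg xB (ltr0_neq0 z0); rewrite ltr0_sg// mulrN1 => h.
    by apply/orP; left; lra.
  + have := reg_sign reg xB (lt0r_neq0 z0); rewrite gtr0_sg// mulr1 => h.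
    apply/negbTE; rewrite negb_or -leNgt !negb_and -!ltNge; apply/andP; split; first lra.
    by apply/orP; right; apply/orP; left; lra.
  + have [h1 h2 h3 h4] := zero i z0.
    by rewrite [x 0 i < _]ltNge h1 [gamma <= _]leNgt h4 !andbF.
Qed.

Lemma I_m_local x : B x -> enorm (res x) < a -> I_m f gamma P x = D.
Proof.
move=> xB xa; have [h1 h2] := index_sets xB xa; rewrite /I_m h1 h2.
by apply/setP => i; rewrite !inE; case: ltgtP.
Qed.

Lemma omega_local x : B x -> enorm (res x) < a -> omega f gamma P x = sign_shift.
Proof.
move=> xB xa; have [h1 h2] := index_sets xB xa.
apply/rowP => i; rewrite [LHS]mxE [RHS]mxE h1 h2 !inE.
case: ltgtP => [z0|z0|<-]; last by rewrite sgr0 mulr0.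
- by rewrite gtr0_sg// mulr1.
- by rewrite ltr0_sg// mulrN1.
Qed.

Lemma cproj_res x : cproj D (res x) = cproj D (g x + sign_shift).
Proof.
apply/rowP => i; rewrite [LHS]mxE [RHS]mxE in_supp.
case: ifP => // /negbTE xi; rewrite [LHS]mxE xi [RHS]mxE; congr (_ + _).
by rewrite mxE.
Qed.

(** The two squared norms in [mu] are those of the parts of [res x] off and on [D]; they add up to
    its squared norm, whose power delta/2 is taken. *)
Lemma mu_local x : B x -> enorm (res x) < a ->
  mu f gamma P x = tm_c P * enorm (res x) `^ tm_delta P.
Proof.
move=> xB xa; rewrite /mu /I_p (I_m_local xB xa) omega_local// prox_residual_local//.
rewrite !enorm_subvec -cproj_res [X in X `^ _]addrC -sqr_enorm_cprojC.
rewrite -powR_mulrn ?enorm_ge0// -powRrM; congr (_ * _ `^ _).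
by field.
Qed.

Lemma res_lipschitz x y : B x -> B y -> enorm (res x - res y) <= (1 + L) * enorm (x - y).
Proof.
move=> xB yB.
have -> : res x - res y = cproj (~: D) (x - y) + cproj D (g x - g y).
  apply/rowP => i; rewrite !mxE finset.in_setC in_supp; case: eqVneq => /= xi.
    by rewrite addr0.
  by rewrite add0r; ring.
apply: le_trans (enormD_le _ _) _.
have := enorm_cproj (~: D) (x - y); have := enorm_cproj D (g x - g y).
have := reg_lip reg xB yB; lra.
Qed.

Lemma res_xs : res xs = 0.
Proof. exact: minimizer_local_residual. Qed.

Lemma res_le x : B x -> enorm (res x) <= (1 + L) * enorm (x - xs).
Proof. by move=> xB; rewrite -[res x]subr0 -res_xs res_lipschitz// xs_in_ball. Qed.

Lemma direction_local x p : B x -> enorm (res x) < a -> 0 < mu f gamma P x ->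
  tmap_direction f gamma P x p ->
  (forall i, xs 0 i = 0 -> p 0 i = g x 0 i) /\
  exists2 e : 'rV[R]_n,
    enorm e <= tm_tau P * Num.min (mu f gamma P x * enorm (cproj D p)) (enorm (cproj D (res x))) &
    cproj D (cproj D p *m hess f x) + mu f gamma P x *: cproj D p = cproj D (res x) + e.
Proof.
move=> xB xa mu0; rewrite /tmap_direction /I_p /H_at (I_m_local xB xa).
rewrite (omega_local xB xa) => -[pA [e [pD eE]]]; split.
  by move=> i xi; apply: pA; rewrite finset.in_setC in_supp xi eqxx.
have [e' e'E h] := direction_cproj (hess_psd f2 fconvex x) mu0 pD.
exists e'; last by rewrite h cproj_res.
have sE : subvec D (g x) + subvec D sign_shift = subvec D (g x + sign_shift).
  by apply/rowP => j; rewrite [LHS]mxE [RHS]mxE [RHS]mxE; congr (_ + _); rewrite mxE.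
by rewrite e'E cproj_res -!enorm_subvec -sE.
Qed.

(** On [D] the clipping at 0 is inactive, because |t p_i| <= a <= |x_i|. *)
Lemma trial_local x p t : B x -> enorm (res x) < a -> 0 < t -> t <= 1 ->
  (forall i, xs 0 i = 0 -> p 0 i = g x 0 i) -> enorm (cproj D p) < a ->
  trial f gamma P x p t =
  \row_i (if xs 0 i == 0 then soft (t * gamma) (x 0 i - t * g x 0 i) else x 0 i - t * p 0 i).
Proof.
have apos := a0.
move=> xB xa t0 t1 pA pa; have [h1 h2] := index_sets xB xa.
apply/rowP => i; rewrite [LHS]mxE [RHS]mxE h1 h2 !inE.
have pi : xs 0 i != 0 -> `|t * p 0 i| <= a.
  move=> xi; have := le_lt_trans (le_abs_enorm (cproj D p) i) pa.
  rewrite mxE in_supp xi normrM (gtr0_norm t0) => h.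
  have := normr_ge0 (p 0 i); nra.
have [z0|z0|z0] := ltgtP (xs 0 i) 0.
- have := reg_sign reg xB (ltr0_neq0 z0); rewrite ltr0_sg// mulrN1 => h.
  have := pi (ltr0_neq0 z0); rewrite ler_norml => /andP[? ?].
  by rewrite min_l//; lra.
- have := reg_sign reg xB (lt0r_neq0 z0); rewrite gtr0_sg// mulr1 => h.
  have := pi (lt0r_neq0 z0); rewrite ler_norml => /andP[? ?].
  by rewrite max_l//; lra.
- by rewrite prox_absE ?mulr_ge0// ?ltW// pA.
Qed.

End Identification.

(** * One step of the algorithm near the limit point *)

Lemma small_powR {R : realType} (e C b : R) : 0 < e -> 0 <= C -> 0 < b ->
  exists2 m0, 0 < m0 & forall m, 0 <= m -> m <= m0 -> C * m `^ e < b.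
Proof.
move=> e0 C0 b0.
have q0 : 0 < b / (C + 1) by rewrite divr_gt0//; lra.
exists ((b / (C + 1)) `^ e^-1); first exact: powR_gt0.
move=> m m_ge0 mle.
have : m `^ e <= b / (C + 1).
  have -> : b / (C + 1) = ((b / (C + 1)) `^ e^-1) `^ e.
    by rewrite -powRrM mulVf ?gt_eqF// powRr1// ltW.
  by apply: ge0_ler_powR; rewrite ?nnegrE ?powR_ge0// ltW.
rewrite ler_pdivlMr; last lra.
have := powR_ge0 m e; nra.
Qed.

Section LocalSteps.
Context {R : realType} {n : nat}.
Variables (f : 'rV[R]_n -> R) (gamma : R) (P : tmap_params R) (xs : 'rV[R]_n).
Variables r a eta L c1 : R.
Hypotheses (f2 : twice_cont_diff f)
  (fconvex : convex_function [set: 'rV[R]_n] f) (gamma0 : 0 < gamma)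
  (Pvalid : valid_params P) (xsmin : minimizers (psi f gamma) xs)
  (reg : regular_at f gamma (tm_eps P) xs r a eta L c1).
Implicit Types (x y z v p e q : 'rV[R]_n).

Local Notation res := (local_residual f gamma xs).
Local Notation D := (supp xs).
Local Notation B x := (enorm (x - xs) < r).
Local Notation g := (grad f).
Local Notation mu := (mu f gamma P).
Local Notation sigma := (tm_sigma P).
Local Notation tau := (tm_tau P).
Local Notation delta := (tm_delta P).

Lemma abs_coord z i : B z -> xs 0 i != 0 -> `|z 0 i| = z 0 i * Num.sg (xs 0 i).
Proof.
move=> zB xi; have := reg_sign reg zB xi; have [_ a0 _ _ _] := reg_pos reg.
have [z0|z0|/eqP] := ltgtP (xs 0 i) 0; last by rewrite (negbTE xi).
  by rewrite ltr0_sg// => h; rewrite ltr0_norm; lra.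
by rewrite gtr0_sg// => h; rewrite gtr0_norm; lra.
Qed.

Lemma ball_segment x v c : B x -> B (x + v) -> 0 <= c -> c <= 1 -> B (x + c *: v).
Proof.
move=> xB vB c0 c1'.
have -> : x + c *: v - xs = (1 - c) *: (x - xs) + c *: (x + v - xs).
  by apply/rowP => i; rewrite !mxE; ring.
apply: le_lt_trans (enormD_le _ _) _; rewrite !enormZ !ger0_norm ?subr_ge0//.
have := enorm_ge0 (x - xs); have := enorm_ge0 (x + v - xs).
by have [c2|c2] := leP c (1 / 2); nra.
Qed.

(** The mean value form yields the constant [L] where the integral form would give L/2. *)
Lemma f_quadratic_upper x v : B x -> B (x + v) ->
  f (x + v) <= f x + dotp (g x) v + L * enorm v ^+ 2.
Proof.
move=> xB vB; have [c [c0 c1' fE]] := MVT_along f2 x v.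
have xcB := ball_segment xB vB c0 c1'.
have := dotp_le_enorm (g (x + c *: v) - g x) v; rewrite dotpBl -fE.
have := reg_lip reg xcB xB; rewrite [X in _ <= L * enorm X]addrAC subrr add0r enormZ ger0_norm//.
have [_ _ _ L0 _] := reg_pos reg; have v0 := enorm_ge0 v.
have h1 : L * (c * enorm v) <= L * enorm v.
  by rewrite ler_wpM2l// ler_piMl.
move=> h2; have h3 := ler_wpM2r v0 (le_trans h2 h1).
by rewrite expr2; lra.
Qed.

(** Test the remainder against itself: the mean value theorem turns its square into a Hessian
    difference between two points of the manifold. *)
Lemma restricted_taylor x v : B x -> B (x + v) ->
  active_manifold xs x -> active_manifold xs v ->
  enorm (cproj D (g (x + v) - g x - v *m hess f x)) <= L * enorm v ^+ 2.
Proof.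
move=> xB vB xM vM; set w := cproj D _.
have [-> |w0] := eqVneq w 0.
  by rewrite enorm0 mulr_ge0// ?exprn_ge0 ?enorm_ge0//; case: (reg_pos reg).
have wD : cproj D w = w by rewrite cproj_id.
have [c [c0 c1' E]] := MVT_grad_along f2 w x v.
have xcB := ball_segment xB vB c0 c1'.
have xcM : active_manifold xs (x + c *: v).
  by move=> i xi; rewrite !mxE xM// vM// mulr0 addr0.
have h := reg_hess reg xcB xB xcM xM vM.
have wE : dotp w w = dotp w (cproj D (v *m (hess f (x + c *: v) - hess f x))).
  have -> : dotp w w = dotp (cproj D w) (g (x + v) - g x - v *m hess f x).
    by rewrite dotp_cprojl.
  by rewrite wD dotpBr E -dotpBr -mulmxBr -dotp_cprojl wD.
rewrite -(ler_pM2l (enorm_gt0 w0)) -expr2 (sqr_enorm w) wE.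
apply: le_trans (dotp_le_enorm _ _) _; rewrite ler_wpM2l ?enorm_ge0//.
apply: le_trans h _; rewrite [X in L * enorm X]addrAC subrr add0r enormZ ger0_norm//.
have [_ _ _ L0 _] := reg_pos reg; have v0 := enorm_ge0 v.
rewrite expr2 mulrA ler_wpM2r// ler_wpM2l//.
by rewrite ler_piMl.
Qed.

Lemma tau_bounds : 0 < tau /\ tau < 1.
Proof. by case: Pvalid => _ _ _ /andP[? ?] _. Qed.

Lemma sigma_bounds : 0 < sigma /\ sigma < 1.
Proof. by case: Pvalid => _ /andP[? ?]. Qed.

Section Direction.
Variables (x p e : 'rV[R]_n).
Hypotheses (mu0 : 0 < mu x)
  (e_small : enorm e <= tau * Num.min (mu x * enorm (cproj D p)) (enorm (cproj D (res x))))
  (system : cproj D (cproj D p *m hess f x) + mu x *: cproj D p = cproj D (res x) + e).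

Lemma residual_le_step : enorm e <= tau * (mu x * enorm (cproj D p)).
Proof.
have [t0 _] := tau_bounds; apply: le_trans e_small _.
by rewrite ler_wpM2l ?(ltW t0)// ge_min lexx.
Qed.

Lemma residual_le_res : enorm e <= tau * enorm (cproj D (res x)).
Proof.
have [t0 _] := tau_bounds; apply: le_trans e_small _.
by rewrite ler_wpM2l ?(ltW t0)// ge_min lexx orbT.
Qed.

Lemma direction_bound : mu x * enorm (cproj D p) <= 2 * enorm (res x).
Proof.
apply: le_trans (psd_shift_coercive (hess_psd f2 fconvex x) mu0 (cproj_id _ _) system) _.
have [t0 t1] := tau_bounds.
have := enormD_le (cproj D (res x)) e; have := residual_le_res.
have := enorm_cproj D (res x); have := enorm_ge0 (cproj D (res x)); nra.
Qed.

(** Pair the system with the step; the inexactness costs at most tau mu |q|^2. *)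
Lemma direction_descent :
  (1 - tau) * mu x * enorm (cproj D p) ^+ 2 + dotp (cproj D p) (cproj D p *m hess f x)
  <= dotp (cproj D p) (res x).
Proof.
have h1 := residual_le_step; set q := cproj D p in h1 *.
have qD : cproj D q = q by rewrite cproj_id.
have -> : dotp q (res x) = dotp q (cproj D (res x)) by rewrite -dotp_cprojl qD.
have -> : cproj D (res x) = cproj D (q *m hess f x) + mu x *: q - e.
  by rewrite system addrK.
rewrite dotpBr dotpDr dotpZr -dotp_cprojl qD -sqr_enorm.
have := dotp_le_enorm q e.
have := ler_wpM2l (enorm_ge0 q) h1; rewrite expr2; nra.
Qed.

End Direction.

Lemma enorm_grad_map x p t : B x -> enorm (res x) < a -> 0 < t ->
  enorm (grad_map f gamma P x p t) = t^-1 * enorm (cproj (~: D) (x - trial f gamma P x p t)).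
Proof.
move=> xB xa t0; rewrite /grad_map enormZ ger0_norm ?invr_ge0 ?ltW//; congr (_ * _).
have -> : subvec (I_p f gamma P x) x - subvec (I_p f gamma P x) (trial f gamma P x p t) =
   subvec (I_p f gamma P x) (x - trial f gamma P x p t).
  apply/rowP => j; rewrite [LHS]mxE [RHS]mxE [RHS]mxE; congr (_ + _); first by rewrite mxE.
  by rewrite [LHS]mxE [RHS]mxE; congr (- _); rewrite [LHS]mxE.
by rewrite enorm_subvec /I_p (I_m_local gamma0 Pvalid reg xB xa).
Qed.

Lemma suff_decreaseE x p t : B x -> enorm (res x) < a -> 0 < t ->
  sigma * t * (1 - tau) * mu x * enorm (cproj D p) ^+ 2 +
  sigma * t * (t^-1 * enorm (cproj (~: D) (x - trial f gamma P x p t))) ^+ 2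
  <= psi f gamma x - psi f gamma (trial f gamma P x p t) ->
  suff_decrease f gamma P x p t.
Proof.
move=> xB xa t0; rewrite /suff_decrease enorm_grad_map// enorm_subvec.
by rewrite (I_m_local gamma0 Pvalid reg xB xa).
Qed.

(** The quadratic error L |v|^2 splits over [D] and its complement. The two smallness conditions on
    [t] let the fraction 1 - sigma of each first-order gain absorb its share. *)
Lemma sufficient_decrease x p e t : B x -> enorm (res x) < a -> 0 < mu x ->
  (forall i, xs 0 i = 0 -> p 0 i = g x 0 i) ->
  enorm e <= tau * Num.min (mu x * enorm (cproj D p)) (enorm (cproj D (res x))) ->
  cproj D (cproj D p *m hess f x) + mu x *: cproj D p = cproj D (res x) + e ->
  enorm (cproj D p) < a -> 0 < t -> t <= 1 -> B (trial f gamma P x p t) ->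
  L * t <= (1 - sigma) * (1 - tau) * mu x -> L * t <= 1 - sigma ->
  suff_decrease f gamma P x p t.
Proof.
move=> xB xa mu0 pA eE sys pa t0 t1 yB Lmu Ls.
apply: suff_decreaseE => //.
have yE := trial_local gamma0 Pvalid reg xB xa t0 t1 pA pa.
move: yB yE; set y := trial _ _ _ _ _ _ => yB yE.
pose v := y - x; have vE : x + v = y by rewrite addrC subrK.
have vB : B (x + v) by rewrite vE.
have := f_quadratic_upper xB vB; rewrite vE => fy.
have pd := direction_descent eE sys.
have Hq := hess_psd f2 fconvex x (cproj D p).
(* First-order gain, coordinate by coordinate: on [D] signs are constant and the absolute value is
   linear; off [D] it is the subgradient inequality of soft thresholding tested at x_i. *)
have key : t * dotp (cproj D p) (res x) + t^-1 * enorm (cproj (~: D) v) ^+ 2 <=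
    l1reg gamma x - l1reg gamma y - dotp (g x) v.
  rewrite /l1reg -mulrBr -sumrB mulr_sumr sqr_enorm !mulr_sumr -big_split -sumrB.
  apply: ler_sum => i _ /=.
  have vi : v 0 i = y 0 i - x 0 i by rewrite mxE [X in _ + X]mxE.
  rewrite [cproj D p 0 i]mxE [cproj _ v 0 i]mxE [res x 0 i]mxE finset.in_setC in_supp vi.
  have [xi|xi] := eqVneq (xs 0 i) 0.
    rewrite mul0r mulr0 add0r /=.
    have yi : y 0 i = soft (t * gamma) (x 0 i - t * g x 0 i).
      by rewrite yE [LHS]mxE xi eqxx.
    have := soft_subgradient (x 0 i - t * g x 0 i) (x 0 i) (ltW (mulr_gt0 t0 gamma0)).
    rewrite -yi ler_pdivrMl//; nra.
  rewrite mulr0 mulr0 addr0 /=.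
  have yi : y 0 i = x 0 i - t * p 0 i by rewrite yE [LHS]mxE (negbTE xi).
  by rewrite (abs_coord xB xi) (abs_coord yB xi) yi; lra.
have -> : enorm (cproj (~: D) (x - y)) = enorm (cproj (~: D) v).
  by rewrite -enormN -cprojN opprB.
have vD : enorm (cproj D v) = t * enorm (cproj D p).
  rewrite -[t in RHS]gtr0_norm// -enormZ -cprojZ -enormN -cprojN; congr (enorm _).
  apply/rowP => i; rewrite [LHS]mxE [RHS]mxE in_supp; case: ifP => // xi.
  rewrite [LHS]mxE [v 0 i]mxE [X in _ + X]mxE yE [X in X + _]mxE (negbTE xi) [RHS]mxE.
  by ring.
move: fy; rewrite (sqr_enorm_cprojC D v) vD /psi.
set Q := enorm (cproj D p) in pd *; set V := enorm (cproj (~: D) v) in key *.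
have [s0 s1] := sigma_bounds; have [tau0 tau1] := tau_bounds.
move=> fy.
have V1 : sigma * t * (t^-1 * V) ^+ 2 + L * V ^+ 2 <= t^-1 * V ^+ 2.
  have -> : sigma * t * (t^-1 * V) ^+ 2 = sigma * (t^-1 * V ^+ 2).
    by field; lra.
  have : (L * t) * (t^-1 * V ^+ 2) <= (1 - sigma) * (t^-1 * V ^+ 2).
    by rewrite ler_wpM2r// mulr_ge0 ?invr_ge0 ?exprn_ge0 ?enorm_ge0// ltW.
  rewrite -mulrA mulVKf ?gt_eqF// mulrBl mul1r; lra.
have Q1 : sigma * t * (1 - tau) * mu x * Q ^+ 2 + L * (t * Q) ^+ 2 <=
    t * ((1 - tau) * mu x * Q ^+ 2).
  have : (L * t) * (t * Q ^+ 2) <= (1 - sigma) * (1 - tau) * mu x * (t * Q ^+ 2).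
    by rewrite ler_wpM2r// mulr_ge0 ?exprn_ge0 ?enorm_ge0// ltW.
  by rewrite exprMn expr2; lra.
have : t * ((1 - tau) * mu x * Q ^+ 2) <= t * dotp (cproj D p) (res x).
  by rewrite ler_pM2l//; lra.
lra.
Qed.

Lemma delta_bounds : 0 < delta /\ 0 < 1 - delta.
Proof. by case: Pvalid => _ _ _ _ [/andP[? ?] _]; split; lra. Qed.

Lemma c_gt0 : 0 < tm_c P.
Proof. by case: Pvalid => _ _ _ _ []. Qed.

Lemma beta_bounds : 0 < tm_beta P /\ tm_beta P < 1.
Proof. by case: Pvalid => _ _ /andP[? ?]. Qed.

Lemma powR_split m : 0 < m -> m `^ delta * m `^ (1 - delta) = m.
Proof.
move=> m0; rewrite -powRD; last by apply/implyP => _; rewrite gt_eqF.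
by rewrite addrC subrK powRr1 ?ltW.
Qed.

Lemma res_gt0 x : B x -> enorm (res x) < a -> 0 < mu x -> 0 < enorm (res x).
Proof.
move=> xB xa; rewrite (mu_local gamma0 Pvalid reg xB xa) => mu0.
rewrite lt_neqAle enorm_ge0 andbT; apply: contraTneq mu0 => <-.
by rewrite powR0 ?mulr0 ?ltxx// gt_eqF//; case: delta_bounds.
Qed.

(** Divide mu |q| <= 2 |res| by mu = c |res|^delta. This coarse bound already makes the step small,
    without the error bound or the manifold. *)
Lemma step_bound x p : B x -> enorm (res x) < a -> 0 < mu x ->
  tmap_direction f gamma P x p ->
  enorm (cproj D p) <= 2 / tm_c P * enorm (res x) `^ (1 - delta).
Proof.
move=> xB xa mu0 dir.
have [_ [e eE sys]] := direction_local f2 fconvex gamma0 Pvalid reg xB xa mu0 dir.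
have m0 := res_gt0 xB xa mu0.
have := direction_bound mu0 eE sys.
rewrite (mu_local gamma0 Pvalid reg xB xa) -{2}(powR_split m0).
have md := powR_gt0 delta m0; have c0 := c_gt0.
rewrite [2 * _]mulrCA -mulrA [_ * (enorm (res x) `^ delta * _)]mulrCA ler_pM2l//.
by rewrite -ler_pdivlMl// mulrA [_^-1 * 2]mulrC.
Qed.

Lemma trial_close x p t : B x -> enorm (res x) < a -> 0 < t -> t <= 1 ->
  (forall i, xs 0 i = 0 -> p 0 i = g x 0 i) -> enorm (cproj D p) < a ->
  enorm (trial f gamma P x p t - x) <= enorm (cproj D p) + enorm (x - xs).
Proof.
move=> xB xa t0 t1 pA pa; have yE := trial_local gamma0 Pvalid reg xB xa t0 t1 pA pa.
set v := _ - x; have -> : v = cproj D v + cproj (~: D) v.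
  apply/rowP => i; rewrite [RHS]mxE [X in _ = X + _]mxE [X in _ = _ + X]mxE finset.in_setC.
  by case: (i \in D); rewrite /= ?addr0 ?add0r.
have vE i : v 0 i = (if xs 0 i == 0 then soft (t * gamma) (x 0 i - t * g x 0 i) - x 0 i
    else - (t * p 0 i)).
  rewrite /v yE [LHS]mxE [X in X + _]mxE [X in _ + X]mxE.
  by case: ifP => _ //; rewrite addrAC subrr add0r.
have g0 := gamma0; have [_ _ eta0 _ _] := reg_pos reg.
apply: le_trans (enormD_le _ _) _; apply: lerD; apply: le_enorm_coord => i.
  rewrite [cproj D v 0 i]mxE [cproj D p 0 i]mxE in_supp vE.
  by case: eqVneq => //= _; rewrite normrN normrM gtr0_norm// ler_piMl.
rewrite [cproj _ v 0 i]mxE finset.in_setC in_supp vE.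
case: eqVneq => [xi|_] /=; last by rewrite normr0.
have -> : (x - xs) 0 i = x 0 i by rewrite !mxE xi subr0.
apply: soft_step_shrinks => //.
have := reg_grad reg xB xi; lra.
Qed.

(** If backtracking occurred, the step t / beta was rejected and hence exceeds kappa mu. *)
Lemma linesearch_lower x p t kappa : 0 < mu x -> 0 < kappa ->
  (forall s, 0 < s -> s <= 1 -> s <= kappa * mu x -> suff_decrease f gamma P x p s) ->
  linesearch f gamma P x p t ->
  [/\ 0 < t, t <= 1 & t = 1 \/ tm_beta P * kappa * mu x <= t].
Proof.
move=> mu0 k0 hs [j [-> _ hmin]]; have [b0 b1] := beta_bounds.
split; [exact: exprn_gt0|by rewrite exprn_ile1// ltW|].
case: j hmin => [|j] hmin; first by left; rewrite expr0.
right; have := hmin j (ltnSn j) => nsd.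
have : ~~ (tm_beta P ^+ j <= kappa * mu x).
  apply/negP => h; apply: nsd; apply: hs => //; first exact: exprn_gt0.
  by rewrite exprn_ile1// ltW.
rewrite -ltNge exprS -mulrA ler_pM2l//; exact: ltW.
Qed.

Lemma identification_step rho : 0 < rho -> exists2 rad, 0 < rad &
  forall x p t, enorm (x - xs) < rad -> 0 < mu x ->
  tmap_direction f gamma P x p -> linesearch f gamma P x p t ->
  active_manifold xs (trial f gamma P x p t) /\ enorm (trial f gamma P x p t - xs) < rho.
Proof.
move=> rho0; have [r0 a0 eta0 L0 _] := reg_pos reg.
have [d0 d1] := delta_bounds; have c0 := c_gt0; have [b0 b1] := beta_bounds.
have [s0 s1] := sigma_bounds; have [tau0 tau1] := tau_bounds; have g0 := gamma0.
(* Chosen so that L kappa <= (1 - sigma)(1 - tau); [L + 1] avoids dividing by 0. *)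
pose kappa := (1 - sigma) * (1 - tau) / (L + 1).
have st0 : 0 < (1 - sigma) * (1 - tau) by rewrite mulr_gt0//; lra.
have k0 : 0 < kappa by rewrite divr_gt0//; lra.
have kL : L * kappa <= (1 - sigma) * (1 - tau).
  have : kappa * (L + 1) = (1 - sigma) * (1 - tau) by rewrite divfK//; lra.
  nra.
have c2 : 0 <= 2 / tm_c P by rewrite divr_ge0// ltW.
pose w := Num.min a (Num.min r rho / 2).
have w0 : 0 < w by rewrite lt_min a0 divr_gt0// lt_min r0.
(* Thresholds on |res x|: [m1] gives |q| < w, [m2] gives mu < 1, and [m3] gives |res|^(1 - delta) <
   beta kappa c eta. *)
have [m1 m10 hm1] := small_powR d1 c2 w0.
have [m2 m20 hm2] := small_powR d0 (ltW c0) ltr01.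
have [m3 m30 hm3] := small_powR d1 ler01 (mulr_gt0 (mulr_gt0 (mulr_gt0 b0 k0) c0) eta0).
pose M := \big[Num.min/a]_(z <- [:: m1; m2; m3]) z.
have M0 : 0 < M by rewrite /M !big_cons big_nil !lt_min m10 m20 m30.
pose rad := Num.min (Num.min r rho / 4) (M / (1 + L)).
exists rad; first by rewrite lt_min !divr_gt0 ?lt_min ?r0//; lra.
move=> x p t; rewrite lt_min => /andP[xr xM] mu0 dir ls.
have xr1 : enorm (x - xs) < r / 4.
  by apply: lt_le_trans xr _; rewrite ler_pM2r// ge_min lexx.
have xr2 : enorm (x - xs) < rho / 4.
  by apply: lt_le_trans xr _; rewrite ler_pM2r// ge_min lexx orbT.
have xB : B x by lra.
have mM : enorm (res x) < M.
  apply: le_lt_trans (res_le f2 xsmin reg xB) _.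
  by rewrite mulrC -ltr_pdivlMr//; lra.
move: mM; rewrite /M !big_cons big_nil !lt_min => /and4P[/ltW mm1 /ltW mm2 /ltW mm3 xa].
have m_ge0 := enorm_ge0 (res x).
have m0 := res_gt0 xB xa mu0.
have muE := mu_local gamma0 Pvalid reg xB xa.
have qw := le_lt_trans (step_bound xB xa mu0 dir) (hm1 _ m_ge0 mm1).
have mu1 : mu x < 1 by rewrite muE; exact: hm2.
have [pA [e eE sys]] := direction_local f2 fconvex gamma0 Pvalid reg xB xa mu0 dir.
move: qw; rewrite lt_min => /andP[qa qr].
have qr1 : enorm (cproj D p) < r / 2.
  by apply: lt_le_trans qr _; rewrite ler_pM2r// ge_min lexx.
have qr2 : enorm (cproj D p) < rho / 2.
  by apply: lt_le_trans qr _; rewrite ler_pM2r// ge_min lexx orbT.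
have close s : 0 < s -> s <= 1 -> enorm (trial f gamma P x p s - xs) <=
    enorm (cproj D p) + 2 * enorm (x - xs).
  move=> s0' s1'; apply: le_trans (enorm_split x _ _) _.
  have := trial_close xB xa s0' s1' pA qa; lra.
have sd s : 0 < s -> s <= 1 -> s <= kappa * mu x -> suff_decrease f gamma P x p s.
  move=> s0' s1' sk.
  have Lk : L * s <= (1 - sigma) * (1 - tau) * mu x.
    by apply: le_trans (ler_wpM2l L0 sk) _; rewrite mulrA ler_pM2r.
  apply: (sufficient_decrease xB xa mu0 pA eE sys qa s0' s1' _ Lk).
    by have := close s s0' s1'; lra.
  by apply: le_trans Lk _; nra.
have [t0 t1 tE] := linesearch_lower mu0 k0 sd ls.
split; last by have := close t t0 t1; lra.
move=> i xi; rewrite (trial_local gamma0 Pvalid reg xB xa t0 t1 pA qa) mxE xi eqxx.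
apply: soft_small; apply: le_trans (ler_normB _ _) _.
have gi := reg_grad reg xB xi.
(* The margin [eta] in the gradient bound leaves room t eta below the threshold t gamma. After
   backtracking, t eta >= beta kappa c eta |res|^delta >= |res| >= |x_i|. *)
have : `|x 0 i| <= t * eta.
  case: tE => [->|tE]; first by rewrite mul1r; case: (reg_small reg xB xi).
  have xm : `|x 0 i| <= enorm (res x).
    by have := le_abs_enorm (res x) i; rewrite [res x 0 i]mxE xi eqxx.
  apply: le_trans xm _; apply: le_trans (ler_wpM2r (ltW eta0) tE).
  rewrite -{1}(powR_split m0) muE.
  have := hm3 _ m_ge0 mm3; rewrite mul1r => h3.
  have md := powR_gt0 delta m0.
  apply: (@le_trans _ _ (enorm (res x) `^ delta * (tm_beta P * kappa * tm_c P * eta))).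
    by rewrite ler_pM2l// ltW.
  by rewrite le_eqVlt; apply/orP; left; apply/eqP; ring.
by rewrite normrM (gtr0_norm t0); have := ler_wpM2l (ltW t0) gi; lra.
Qed.

(** The factor 2 leaves a positive gap above the infimum, so some minimizer realizes the bound
    without the distance having to be attained. *)
Lemma near_minimizer x : B x -> enorm (res x) < a -> 0 < enorm (res x) ->
  exists2 xh, minimizers (psi f gamma) xh & enorm (x - xh) <= 2 * c1 * enorm (res x).
Proof.
move=> xB xa m0; have [_ _ _ _ c10] := reg_pos reg.
have := reg_eb reg xB; rewrite (prox_residual_local gamma0 reg xB xa) => ed.
have lt2 : Defs.edist x (minimizers (psi f gamma)) < 2 * c1 * enorm (res x).
  by apply: le_lt_trans ed _; rewrite -mulrA ltr_pMl ?mulr_gt0// ltrDl.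
have hi : has_inf [set enorm (x - y) | y in minimizers (psi f gamma)].
  split; first by exists (enorm (x - xs)), xs.
  by exists 0 => _ [y _ <-]; exact: enorm_ge0.
have gap : 0 < 2 * c1 * enorm (res x) - Defs.edist x (minimizers (psi f gamma)).
  by rewrite subr_gt0.
have [_ [xh xhmin <-] h] := inf_adherent gap hi.
by exists xh => //; move: h; rewrite /Defs.edist; lra.
Qed.

(** A nonzero entry off [D] would force |(grad f z)_i| = gamma, against the margin [eta]. *)
Lemma minimizer_in_ball z : B z -> minimizers (psi f gamma) z ->
  active_manifold xs z /\ res z = 0.
Proof.
move=> zB zmin; have [_ a0 eta0 _ _] := reg_pos reg; have g0 := gamma0.
have zM : active_manifold xs z.
  move=> i xi; apply/eqP/negPn/negP => zi.
  have := minimizer_stationary f2 zmin zi; have := reg_grad reg zB xi.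
  rewrite ler_norml => /andP[].
  have [z0|z0|/eqP] := ltgtP (z 0 i) 0; last by rewrite (negbTE zi).
    by rewrite ltr0_sg//; lra.
  by rewrite gtr0_sg//; lra.
split=> //; apply/rowP => i; rewrite [LHS]mxE [RHS]mxE.
case: eqVneq => [|xi]; first exact: zM.
have h := reg_sign reg zB xi.
have sE : Num.sg (z 0 i) = Num.sg (xs 0 i).
  have [z0|z0|/eqP] := ltgtP (xs 0 i) 0; last by rewrite (negbTE xi).
    by move: h; rewrite ltr0_sg// => h; rewrite ltr0_sg//; lra.
  by move: h; rewrite gtr0_sg// => h; rewrite gtr0_sg//; lra.
rewrite -sE; apply: minimizer_stationary => //.
by apply: contraTneq h => ->; rewrite mul0r -ltNge.
Qed.

Lemma resD x : active_manifold xs x -> cproj D (res x) = res x.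
Proof.
move=> xM; apply/rowP => i; rewrite [LHS]mxE in_supp.
by case: eqP => //= xi; rewrite mxE xi eqxx xM.
Qed.

Lemma resB x y : active_manifold xs x -> active_manifold xs y ->
  res y - res x = cproj D (g y - g x).
Proof.
move=> xM yM; rewrite -(resD xM) -(resD yM) -cprojB.
apply/rowP => i; rewrite [LHS]mxE [RHS]mxE in_supp.
case: eqVneq => //= xi; rewrite [LHS]mxE [X in _ + X]mxE [X in X + _]mxE (negbTE xi).
by rewrite [X in _ - X]mxE (negbTE xi) [RHS]mxE [X in _ = _ + X]mxE; ring.
Qed.

Lemma l1reg_manifold x : B x -> active_manifold xs x ->
  l1reg gamma x = dotp (sign_shift gamma xs) x.
Proof.
move=> xB xM; rewrite /l1reg mulr_sumr; apply: eq_bigr => i _; rewrite mxE.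
have [xi|xi] := eqVneq (xs 0 i) 0; first by rewrite xM// normr0 !mulr0.
by rewrite (abs_coord xB xi); ring.
Qed.

(** * The unit regularized Newton step on the active manifold *)

Section UnitStep.
Variables (x p e : 'rV[R]_n).
Hypotheses (xB : B x) (xM : active_manifold xs x) (mu0 : 0 < mu x)
  (eE : enorm e <= tau * Num.min (mu x * enorm (cproj D p)) (enorm (cproj D (res x))))
  (sys : cproj D (cproj D p *m hess f x) + mu x *: cproj D p = cproj D (res x) + e).

Local Notation q := (cproj D p).

Lemma step_active : active_manifold xs q.
Proof. by apply/supp_cproj; rewrite cproj_id. Qed.

Lemma opp_step_active : active_manifold xs (- q).
Proof. by move=> i xi; rewrite mxE step_active// oppr0. Qed.

Lemma unit_step_active : active_manifold xs (x - q).
Proof. by move=> i xi; rewrite mxE xM// add0r opp_step_active. Qed.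

(** With u = x - xh and [E] the Taylor error of res(x) = H u + E, the vector q - u solves the
    shifted system with right-hand side E + e - mu u. Coercivity and L |u| <= mu give |q - u| <= 2
    |u| + tau |q|. *)
Lemma unit_step_le xh : B xh -> minimizers (psi f gamma) xh ->
  L * enorm (x - xh) <= mu x -> (1 - tau) * enorm q <= 3 * enorm (x - xh).
Proof.
move=> xhB xhmin Lu; have [xhM rh] := minimizer_in_ball xhB xhmin.
move: Lu; set u := x - xh => Lu.
have uM : active_manifold xs u by move=> i xi; rewrite !mxE xM// xhM// subrr.
have NuM : active_manifold xs (- u) by move=> i xi; rewrite mxE uM// oppr0.
have xuE : x + - u = xh by rewrite /u opprB addrC subrK.
have xuB : B (x + - u) by rewrite xuE.
have tay := restricted_taylor xB xuB xM NuM.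
pose E := - cproj D (g (x + - u) - g x - - u *m hess f x).
have Esmall : enorm E <= L * enorm u ^+ 2 by rewrite enormN -(enormN u).
have resE : res x = cproj D (u *m hess f x) + E.
  rewrite /E cprojB -resB ?xuE// rh mulNmx cprojN.
  by rewrite sub0r opprK opprD opprK addrCA subrr addr0.
have dsys : cproj D ((q - u) *m hess f x) + mu x *: (q - u) = E + e - mu x *: u.
  rewrite mulmxBl cprojB scalerBr addrACA sys resD// resE.
  by rewrite -(addrA (cproj D (u *m hess f x))) addrACA subrr add0r.
have dD : cproj D (q - u) = q - u by rewrite cprojB cproj_id; congr (_ - _); apply/supp_cproj.
have du := psd_shift_coercive (hess_psd f2 fconvex x) mu0 dD dsys.
have qle : enorm q <= enorm (q - u) + enorm u.
  by have := enormD_le (q - u) u; rewrite subrK.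
have e1 := residual_le_step eE.
have h5 : enorm (E + e - mu x *: u) <= L * enorm u ^+ 2 + tau * (mu x * enorm q) + mu x * enorm u.
  apply: le_trans (enormB_le _ _) _; rewrite enormZ (gtr0_norm mu0) lerD2r.
  by apply: le_trans (enormD_le _ _) _; apply: lerD.
have h6 : L * enorm u ^+ 2 <= mu x * enorm u.
  by rewrite expr2 mulrA ler_wpM2r// enorm_ge0.
have h7 : mu x * enorm q <= mu x * (enorm (q - u) + enorm u) by rewrite ler_pM2l.
rewrite -(ler_pM2l mu0); lra.
Qed.

Hypothesis yB : B (x - q).

(** By the system, the linearized residual res(x) - H q equals mu q - e; Taylor's formula adds the
    quadratic term. *)
Lemma res_unit_step :
  enorm (res (x - q)) <= (1 + tau) * (mu x * enorm q) + L * enorm q ^+ 2.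
Proof.
have tay := restricted_taylor xB yB xM opp_step_active.
move: tay; set w := cproj D (_ - _) => tay.
have -> : res (x - q) = (mu x *: q - e) + w.
  have -> : mu x *: q - e = res x - cproj D (q *m hess f x).
    apply/eqP; rewrite subr_eq addrAC eq_sym subr_eq eq_sym; apply/eqP.
    by rewrite [mu x *: q + _]addrC sys resD.
  rewrite /w cprojB -(resB xM unit_step_active) mulNmx cprojN opprK.
  set A := cproj D (q *m _).
  by rewrite [RHS]addrC -addrA [A + _]addrCA subrr addr0 subrK.
rewrite enormN in tay; apply: le_trans (enormD_le _ _) _; apply: lerD => //.
apply: le_trans (enormB_le _ _) _; rewrite enormZ (gtr0_norm mu0) mulrDl mul1r lerD2l.
exact: residual_le_step.
Qed.

Hypotheses (xa : enorm (res x) < a) (pA : forall i, xs 0 i = 0 -> p 0 i = g x 0 i)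
  (qa : enorm q < a).

Lemma unit_trial : trial f gamma P x p 1 = x - q.
Proof.
have [_ _ eta0 _ _] := reg_pos reg.
rewrite (trial_local gamma0 Pvalid reg xB xa ltr01 (lexx _) pA qa).
apply/rowP => i; rewrite [LHS]mxE; case: eqVneq => xi.
  rewrite unit_step_active// soft_small// !mul1r xM// sub0r normrN.
  by apply: le_trans (reg_grad reg xB xi) _; rewrite gerBl ltW.
by rewrite mul1r [RHS]mxE; congr (_ + _); rewrite [RHS]mxE [q 0 i]mxE in_supp xi.
Qed.

(** On the manifold psi is smooth near [xs], so the second-order expansion loses only L |q|^3. A
    loss of L |q|^2 could not be absorbed by mu |q|^2, since mu tends to 0 with the residual. *)
Lemma unit_psi_decrease : (1 - tau) * mu x * enorm q ^+ 2 - L * enorm q * enorm q ^+ 2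
  <= psi f gamma x - psi f gamma (x - q).
Proof.
have [_ _ _ L0 _] := reg_pos reg; have q0 := enorm_ge0 q.
have [c [cge0 cle1 fE]] := MVT_along f2 x (- q).
have xcB := ball_segment xB yB cge0 cle1.
have xcM : active_manifold xs (c *: - q).
  by move=> i xi; rewrite mxE opp_step_active// mulr0.
have := restricted_taylor xB xcB xM xcM.
set W := _ - c *: - q *m _ => tay.
have hW := dotp_le_enorm q (- cproj D W).
rewrite enormN dotpNr -dotp_cprojl cproj_id in hW.
have Wq : L * enorm (c *: - q) ^+ 2 <= L * enorm q ^+ 2.
  rewrite ler_wpM2l// enormZ enormN (ger0_norm cge0) exprMn ler_piMl ?sqr_ge0//.
  by rewrite exprn_ile1.
have hW2 := ler_wpM2l q0 (le_trans tay Wq).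
have psiE : psi f gamma x - psi f gamma (x - q) =
    dotp q (res x) + dotp q W - c * dotp q (q *m hess f x).
  rewrite /psi (l1reg_manifold xB xM) (l1reg_manifold yB unit_step_active).
  have -> : dotp q (res x) = dotp q (g x) + dotp q (sign_shift gamma xs).
    by rewrite !dotp_cprojl cproj_res -!dotp_cprojl dotpDr.
  rewrite /W !dotpBr -scalemxAl mulNmx dotpZr dotpNr.
  rewrite dotpNr (dotpC (g (x + c *: - q)) q) in fE.
  rewrite (dotpC (sign_shift gamma xs) q).
  lra.
rewrite psiE.
have := direction_descent eE sys.
have := ler_piMl (hess_psd f2 fconvex x q) cle1.
lra.
Qed.

Lemma unit_suff_decrease :
  L * enorm q <= (1 - sigma) * (1 - tau) * mu x -> suff_decrease f gamma P x p 1.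
Proof.
move=> q3; apply: suff_decreaseE => //; rewrite unit_trial subKr.
have -> : cproj (~: D) q = 0.
  apply/rowP => i; rewrite [LHS]mxE finset.in_setC in_supp [RHS]mxE.
  by case: eqVneq => //= xi; rewrite step_active.
rewrite enorm0 mulr0 expr0n /= mulr0 addr0 mulr1.
apply: le_trans unit_psi_decrease.
have := ler_wpM2r (sqr_ge0 (enorm q)) q3; lra.
Qed.

End UnitStep.

Lemma newton_step : exists rad Cp Cw, [/\ 0 < rad, 0 <= Cp, 0 <= Cw &
  forall x p t, enorm (x - xs) < rad -> active_manifold xs x -> 0 < mu x ->
  tmap_direction f gamma P x p -> linesearch f gamma P x p t ->
  [/\ active_manifold xs (trial f gamma P x p t),
      enorm (trial f gamma P x p t - x) <= Cp * enorm (res x)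
    & enorm (res (trial f gamma P x p t)) <=
      Cw * enorm (res x) `^ delta * enorm (res x)]].
Proof.
have [r0 a0 eta0 L0 c10] := reg_pos reg.
have [d0 d1] := delta_bounds; have c0 := c_gt0.
have [s0 s1] := sigma_bounds; have [tau0 tau1] := tau_bounds.
have tau10 : 0 < 1 - tau by rewrite subr_gt0.
(* From (1 - tau) |q| <= 3 |u| and |u| <= 2 c1 |res|. In [Cw], the first term bounds (1 + tau) mu
   |q| and the second bounds L |q|^2. *)
pose Cp := 6 * c1 / (1 - tau).
have Cp0 : 0 < Cp by rewrite divr_gt0// mulr_gt0.
pose Cw := 2 * tm_c P * Cp + L * Cp ^+ 2.
have Cp0' := ltW Cp0; have c0' := ltW c0; have c10' := ltW c10.
have Cw0 : 0 <= Cw 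
  by apply: addr_ge0 (mulr_ge0 (mulr_ge0 _ c0') Cp0') (mulr_ge0 L0 (exprn_ge0 _ Cp0')).
have C1 : 0 <= 2 * c1 + Cp by apply: addr_ge0 (mulr_ge0 _ c10') Cp0'.
have st0 : 0 < (1 - sigma) * (1 - tau) by rewrite mulr_gt0// subr_gt0.
have c2 : 0 <= 2 / tm_c P by rewrite divr_ge0// ltW.
have Lc0 : 0 <= 2 * L * c1 by rewrite !mulr_ge0// ltW.
have LC0 : 0 <= L * Cp by rewrite mulr_ge0// ltW.
(* Thresholds on |res x|: [m1] gives |q| < a, [m2] gives L |u| <= mu, [m3] gives L |q| <= (1 -
   sigma)(1 - tau) mu, and [m4] gives |res| <= |res|^delta. *)
have [m1 m10 hm1] := small_powR d1 c2 a0.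
have [m2 m20 hm2] := small_powR d1 Lc0 c0.
have [m3 m30 hm3] := small_powR d1 LC0 (mulr_gt0 st0 c0).
have [m4 m40 hm4] := small_powR d1 ler01 (@ltr01 R).
pose M := \big[Num.min/a]_(z <- [:: m1; m2; m3; m4]) z.
have M0 : 0 < M by rewrite /M !big_cons big_nil !lt_min m10 m20 m30 m40.
have L10 : 0 < 1 + L by rewrite ltr_wpDr.
have CL0 : 0 <= (2 * c1 + Cp) * (1 + L) by rewrite mulr_ge0// ltW.
(* Radius r / S keeps the nearby minimizer and x - q in the ball, as |res| <= (1 + L) |x - xs|. *)
pose S := 1 + (2 * c1 + Cp) * (1 + L).
have S0 : 0 < S by rewrite ltr_wpDr.
exists (Num.min (r / S) (M / (1 + L))), Cp, Cw; split => //.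
  by rewrite lt_min !divr_gt0.
move=> x p t; rewrite lt_min !ltr_pdivlMr// => /andP[xS xM'] xM mu0 dir ls.
have xn := enorm_ge0 (x - xs).
have xB : B x.
  by apply: le_lt_trans xS; rewrite ler_peMr// lerDl.
have mL := res_le f2 xsmin reg xB; rewrite mulrC in mL.
have := le_lt_trans mL xM'; rewrite /M !big_cons big_nil !lt_min.
move=> /and5P[/ltW mm1 /ltW mm2 /ltW mm3 /ltW mm4 xa].
have m_ge0 := enorm_ge0 (res x).
have m0 := res_gt0 xB xa mu0.
have muE := mu_local gamma0 Pvalid reg xB xa.
have qa := le_lt_trans (step_bound xB xa mu0 dir) (hm1 _ m_ge0 mm1).
have [pA [e eE sys]] := direction_local f2 fconvex gamma0 Pvalid reg xB xa mu0 dir.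
have md := powR_gt0 delta m0; have mE := powR_split m0.
have := hm2 _ m_ge0 mm2; have := hm3 _ m_ge0 mm3; have := hm4 _ m_ge0 mm4.
have scale C b : C * enorm (res x) `^ (1 - delta) < b ->
    C * enorm (res x) <= b * enorm (res x) `^ delta.
  move=> h; rewrite -[X in C * X]mE mulrCA [leRHS]mulrC.
  by rewrite ler_pM2l// ltW.
move=> /scale h4 /scale h3 /scale h2; rewrite !mul1r in h4.
have [xh xhmin xxh] := near_minimizer xB xa m0.
have slack : enorm (x - xs) + (2 * c1 + Cp) * enorm (res x) < r.
  apply: le_lt_trans xS; rewrite mulrDr mulr1 lerD2l mulrA [_ * (2 * c1 + Cp)]mulrC -mulrA.
  by rewrite ler_wpM2l.
have Cpm : 0 <= Cp * enorm (res x) by rewrite mulr_ge0.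
have c1m : 0 <= 2 * c1 * enorm (res x) by rewrite !mulr_ge0.
have xhB : B xh.
  apply: le_lt_trans (enorm_split x _ _) _; rewrite enormBC.
  lra.
have qm : enorm (cproj D p) <= Cp * enorm (res x).
  have Lu : L * enorm (x - xh) <= mu x.
    rewrite muE; apply: le_trans h2; apply: le_trans (ler_wpM2l L0 xxh) _.
    by rewrite le_eqVlt; apply/orP; left; apply/eqP; ring.
  have := unit_step_le xB xM mu0 eE sys xhB xhmin Lu.
  rewrite /Cp mulrAC ler_pdivlMr// mulrC.
  lra.
have yB : B (x - cproj D p).
  rewrite addrAC; apply: le_lt_trans (enormB_le _ _) _.
  lra.
have q3 : L * enorm (cproj D p) <= (1 - sigma) * (1 - tau) * mu x.
  apply: le_trans (ler_wpM2l L0 qm) _.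
  by rewrite muE mulrA [leRHS]mulrA.
have sd1 := unit_suff_decrease xB xM eE sys yB xa pA qa q3.
have t1 : t = 1.
  by case: ls => -[|j] [-> _ hmin] //; have := hmin 0%N isT; rewrite expr0.
rewrite t1 (unit_trial xB xM xa pA qa); split.
- exact: unit_step_active.
- by rewrite addrAC subrr add0r enormN.
apply: le_trans (res_unit_step xB xM mu0 eE sys yB) _.
have q0 := enorm_ge0 (cproj D p).
have hmq : mu x * enorm (cproj D p) <=
    tm_c P * Cp * (enorm (res x) `^ delta * enorm (res x)).
  rewrite muE; have := ler_wpM2l (ltW (mulr_gt0 c0 md)) qm.
  lra.
have hqq : enorm (cproj D p) ^+ 2 <= Cp ^+ 2 * (enorm (res x) `^ delta * enorm (res x)).
  rewrite expr2; apply: le_trans (ler_pM q0 q0 qm qm) _.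
  by rewrite mulrACA -expr2 ler_wpM2l ?sqr_ge0// ler_wpM2r.
have := ler_wpM2l L0 hqq.
have : tau * (mu x * enorm (cproj D p)) <= mu x * enorm (cproj D p).
  by apply: ler_piMl (ltW tau1); rewrite mulr_ge0// ltW.
rewrite /Cw; lra.
Qed.

End LocalSteps.

(** * Convergence *)

(** Halving means m_i <= 2 (m_i - m_{i+1}), so the sum of the step bounds C m_i telescopes. *)
Lemma enorm_telescope {R : realType} {n : nat} (u : nat -> 'rV[R]_n) (m : nat -> R)
    (C : R) (k j : nat) : 0 <= C ->
  (forall i, (i < j)%N -> enorm (u (k + i).+1 - u (k + i)%N) <= C * m (k + i)%N /\
     m (k + i).+1 <= m (k + i)%N / 2) ->
  enorm (u (k + j)%N - u k) <= 2 * C * (m k - m (k + j)%N).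
Proof.
move=> C0; elim: j => [|j IH] h; first by rewrite addn0 !subrr enorm0 mulr0.
have [h1 h2] := h j (ltnSn j).
have {}IH := IH (fun i ij => h i (ltnW ij)).
rewrite addnS; apply: le_trans (enorm_split (u (k + j)%N) _ _) _.
have := ler_wpM2l C0 h2; lra.
Qed.

Lemma cluster_frequently {R : realType} {n : nat} (u : nat -> 'rV[R]_n) xs (rho : R) (K : nat) :
  cluster (u @ \oo) xs -> 0 < rho ->
  exists2 k, (K <= k)%N & enorm (u k - xs) < rho.
Proof.
move=> cl rho0.
have A : (u @ \oo) [set u k | k in [set k | (K <= k)%N]].
  by exists K => // k /= Kk; exists k.
have b : nbhs xs (eball xs rho) by apply/nbhs_enormP; exists rho.
by have [_ [[k Kk <-] h]] := cl _ _ A b; exists k.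
Qed.

Theorem theorem4p4 (R : realType) (n : nat) (f : 'rV[R]_n -> R) (gamma : R)
    (P : tmap_params R) (x p : nat -> 'rV[R]_n) (t : nat -> R)
    (Lg : R) (U : set 'rV[R]_n) (xs : 'rV[R]_n) :
  twice_cont_diff f ->
  convex_function [set: 'rV[R]_n] f ->
  0 < gamma ->
  valid_params P ->
  (forall a : R, bounded_set (sublevel (psi f gamma) a)) ->
  open U ->
  convex_set U ->
  sublevel (psi f gamma) (psi f gamma (x 0%N)) `<=` U ->
  (forall k j : nat, U (trial f gamma P (x k) (p k) (tm_beta P ^+ j))) ->
  elipschitz_on Lg U (grad f) ->
  tmap_run f gamma P x p t ->
  (forall k : nat, 0 < mu f gamma P (x k)) ->
  cluster (x @ \oo) xs ->
  minimizers (psi f gamma) xs ->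
  strict_complementarity f gamma xs ->
  error_bound f gamma xs ->
  lipschitz_hessian f xs ->
  (exists K : nat, forall k : nat, (K <= k)%N -> active_manifold xs (x k)) /\
  (x @ \oo --> xs) /\
  (exists C : R, \forall k \near \oo,
     enorm (x k.+1 - xs) <= C * enorm (x k - xs) `^ (1 + tm_delta P)).
Proof.
move=> f2 fconvex gamma0 Pvalid _ oU _ subU _ lipU run mu0 cl xsmin sc eb lh.
have Uxs : U xs by apply: subU; exact: xsmin.
have eps0 : 0 < tm_eps P by case: Pvalid.
have [r [a [eta [L [c1 reg]]]]] := regular_at_limit gamma0 eps0 oU Uxs lipU sc eb lh.
have [r0 _ _ L0 _] := reg_pos reg.
have [d0 _] := delta_bounds Pvalid.
have [rad [Cp [Cw [rad0 Cp0 Cw0 newton]]]] := newton_step f2 fconvex gamma0 Pvalid xsmin reg.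
have L10 : 0 < 1 + L by rewrite ltr_wpDr.
have half0 : 0 < 1 / 2 :> R by rewrite divr_gt0.
have [m1 m10 hm1] := small_powR d0 Cw0 half0.
(* The last radius makes Cw |res|^delta < 1/2, so each Newton step halves the residual. *)
pose rad2 := Num.min rad (Num.min r (m1 / (1 + L))).
have rad20 : 0 < rad2 by rewrite !lt_min rad0 r0 divr_gt0.
(* Starting within rho / T of [xs], the initial distance plus the total travel 2 Cp |res| stays
   below rho. *)
pose T := 1 + 2 * Cp * (1 + L).
have T0 : 0 < T by rewrite ltr_wpDr// !mulr_ge0// ltW.
have [rad1 rad10 ident] := identification_step f2 fconvex gamma0 Pvalid xsmin reg (divr_gt0 rad20 T0).
have [k0 _ xk0] := cluster_frequently 0 cl rad10.
have [dir0 ls0 x1E] := run k0.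
have [xKM xKr] := ident _ _ _ xk0 (mu0 k0) dir0 ls0.
rewrite -x1E in xKM xKr; set K := k0.+1 in xKM xKr.
pose m k := enorm (local_residual f gamma xs (x k)).
have m_ge0 k : 0 <= m k by exact: enorm_ge0.
have mle k : enorm (x k - xs) < rad2 -> m k <= (1 + L) * enorm (x k - xs).
  by rewrite !lt_min => /and3P[_ xr _]; exact: (res_le f2 xsmin reg xr).
have step k : active_manifold xs (x k) -> enorm (x k - xs) < rad2 ->
    [/\ active_manifold xs (x k.+1), enorm (x k.+1 - x k) <= Cp * m k,
        m k.+1 <= Cw * m k `^ tm_delta P * m k & m k.+1 <= m k / 2].
  move=> xM xr; have mk := mle _ xr.
  move: xr; rewrite !lt_min => /and3P[xr _]; rewrite ltr_pdivlMr// mulrC => xm1.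
  have [dir ls xE] := run k.
  have [yM ym yw] := newton _ _ _ xr xM (mu0 k) dir ls.
  rewrite -xE in yM ym yw; split => //; apply: le_trans yw _.
  have := hm1 _ (m_ge0 k) (ltW (le_lt_trans mk xm1)).
  by have := m_ge0 k; rewrite /m; nra.
have near_start z : enorm (z - x K) <= 2 * Cp * m K -> enorm (z - xs) < rad2.
  move=> h; apply: le_lt_trans (enorm_split (x K) _ _) _.
  have xKr2 : enorm (x K - xs) < rad2.
    apply: lt_le_trans xKr _; rewrite ler_pdivrMr// ler_peMr ?(ltW rad20)//.
    by rewrite lerDl !mulr_ge0// ltW.
  have := ler_wpM2l (mulr_ge0 (ler0n R 2) Cp0) (mle _ xKr2).
  have := xKr; rewrite ltr_pdivlMr// /T; lra.
(* All indices up to [j] are carried along, because telescoping from [K] uses every intermediate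
   step. *)
have inv j : (forall i, (i <= j)%N -> active_manifold xs (x (K + i)%N) /\
                            enorm (x (K + i)%N - xs) < rad2).
  elim: j => [|j IH] i.
    rewrite leqn0 => /eqP ->; rewrite addn0; split=> //.
    by apply: near_start; rewrite subrr enorm0 !mulr_ge0.
  rewrite leq_eqVlt => /orP[/eqP ->|]; last by rewrite ltnS => /IH.
  have [xM xr] := IH j (leqnn j); have [yM _ _ _] := step _ xM xr.
  rewrite addnS; split=> //; apply: near_start; rewrite -addnS.
  apply: (le_trans (@enorm_telescope _ _ x m Cp K j.+1 Cp0 _)).
    by move=> l lj; have [zM zr] := IH l lj; have [] := step _ zM zr.
  by rewrite ler_wpM2l ?mulr_ge0// gerBl.
have good k : (K <= k)%N -> active_manifold xs (x k) /\ enorm (x k - xs) < rad2.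
  by move=> Kk; have := inv _ _ (leqnn (k - K)%N); rewrite subnKC.
have dist k l : (K <= k)%N -> (k <= l)%N -> enorm (x l - x k) <= 2 * Cp * m k.
  move=> Kk kl; rewrite -(subnKC kl).
  apply: (le_trans (@enorm_telescope _ _ x m Cp k (l - k) Cp0 _)).
    move=> i _; have [|zM zr] := good (k + i)%N; first exact: leq_trans (leq_addr _ _).
    by have [] := step _ zM zr.
  by rewrite ler_wpM2l ?mulr_ge0// gerBl.
(* Compare with a later iterate arbitrarily close to [xs], which exists as [xs] is a limit point. *)
have lim_le k : (K <= k)%N -> enorm (x k - xs) <= 2 * Cp * m k.
  move=> Kk; apply/ler_addgt0Pr => e e0.
  have [l kl xl] := cluster_frequently k cl e0.
  apply: le_trans (enorm_split (x l) _ _) _; rewrite enormBC.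
  by have := dist _ _ Kk kl; lra.
split; first by exists K => k /good[].
split.
  move=> A /nbhs_enormP[rho rho0 rhoA].
  have [k1 Kk1 xk1] := cluster_frequently K cl (divr_gt0 rho0 T0).
  exists k1 => // l /= k1l; apply: rhoA; rewrite /eball /=.
  apply: le_lt_trans (enorm_split (x k1) _ _) _.
  have := dist _ _ Kk1 k1l; have [_ xr] := good _ Kk1.
  have := ler_wpM2l (mulr_ge0 (ler0n R 2) Cp0) (mle _ xr).
  move: xk1; rewrite ltr_pdivlMr// /T; lra.
(* Chain of |x_{k+1} - xs| <= 2 Cp m_{k+1}, m_{k+1} <= Cw m_k^(1 + delta) and m_k <= (1 + L) |x_k -
   xs|. *)
exists (2 * Cp * (Cw * (1 + L) `^ tm_delta P * (1 + L))).
exists K => // k /= Kk; have [xM xr] := good _ Kk; have [_ _ mS _] := step _ xM xr.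
apply: le_trans (lim_le _ (leqW Kk)) _; rewrite -[leRHS]mulrA ler_wpM2l ?mulr_ge0//.
apply: le_trans mS _.
have e0 := enorm_ge0 (x k - xs); have mk := mle _ xr.
have md : m k `^ tm_delta P <= (1 + L) `^ tm_delta P * enorm (x k - xs) `^ tm_delta P.
  rewrite -powRM ?(ltW L10)//; apply: ge0_ler_powR; rewrite ?nnegrE ?(ltW d0)//.
  by rewrite mulr_ge0// ltW.
have -> : enorm (x k - xs) `^ (1 + tm_delta P) =
    enorm (x k - xs) * enorm (x k - xs) `^ tm_delta P.
  have d1 : 1 + tm_delta P == 0 = false by rewrite gt_eqF// addr_gt0.
  by rewrite powRD ?d1// powRr1.
have := ler_pM (powR_ge0 _ _) (m_ge0 k) md mk => h.
by have := ler_wpM2l Cw0 h; lra.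
Qed.
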